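(* Let $(x_r)_{r\in\mathbb N}$ be a normalized block sequence of $(e_i)$ in $X_{\mathcal D}$. Then there exists an infinite subset $\Omega\subset\mathbb N$ such that, for every $j_0\in\mathbb N$, $$\Big\|\sum_{r\in\Gamma}c_r x_r\Big\|\ \ge\ 0.99\,\frac1{m_{j_0}}\sum_{r\in\Gamma}|c_r|$$ for every subset $\Gamma\subset\Omega$ such that $(x_r)_{r\in\Gamma}$ is $S_{n_{j_0}}$-admissible and for every choice $(c_r)_{r\in\Gamma}$ of scalars.
   Context: Schreier families. $S_0=\{\{i\}: i\in\mathbb N\}$, $S_1=\{F\subset\mathbb N:\mathrm{card}(F)\le\min F\}$, and $S_{n+1}=\{F_1\cup\dots\cup F_d:\ d\le\min F_1,\ F_1<\dots<F_d,\ F_i\in S_n\}$, where $A<B$ means $\max A<\min B$. For finitely supported vectors, $x<y$ means $\mathrm{supp}(x)<\mathrm{supp}(y)$; a block sequence of $(e_i)$ is a sequence of successive vectors $x_1<x_2<\cdots$ in $c_{00}$. A finite block sequence $x_1<\dots<x_k$ is $S_n$-admissible if $\{\min\mathrm{supp}(x_i)\}_{i=1}^k\in S_n$. Parameters. Fix strictly increasing sequences $(m_j)_{j\ge1}$, $(n_j)_{j\ge1}$ of positive integers with $m_1=100$, $n_1=1$, $m_{j+1}\ge j^2m_j^2$ and $n_{j+1}>\frac{4}{\log(100)}n_j\log(m_{j+1})$ for all $j$. Tree. $\mathcal D=\bigcup_{n\ge0}\{0,1\}^n$ is the binary tree, ordered by initial segments, with minimum the empty sequence $\emptyset$. It carries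 the metric $d(\lambda,\lambda)=0$ and, for $\lambda\ne\mu$, $d(\lambda,\mu)=2^{-n}$, where $n$ is the maximal height of a common initial segment of $\lambda,\mu$. $\overline{\mathcal D}$ is its (compact) completion. $\phi:\{\infty\}\cup\{m_j:j\in\mathbb N\}\to\mathcal D$ is the bijection enumerating $\mathcal D$ by height and lexicographically within each height: $\phi(\infty)=\emptyset$, $\phi(m_1)=(0)$, $\phi(m_2)=(1)$, $\phi(m_3)=(0,0)$, etc. One writes $d(m_j,\cdot)$ for $d(\phi(m_j),\cdot)$, and likewise $d(\infty,\cdot)=d(\phi(\infty),\cdot)$. Norming set. $(e_i)$ is the unit vector basis of $c_{00}$, written $e_i^*$ when viewed as functionals; $c_{00}$ acts on itself by the standard pairing. $W_0=\{\pm e_i^*\}_{i\ge1}$, with $w(\pm e_i^* )=m(\pm e_i^* )=\infty$. $W_1$ is $W_0$ together with all $f=\frac1{m_{j_1}\cdots m_{j_l}}\sum_{k=1}^d e^*_{i_k}$ where $l\ge 1$ and $e^*_{i_1}<\dots<e^*_{i_d}$ are $S_{n_{j_1}+\dots+n_{j_l}}$-admissible. For such $f$, $\vec w(f)=(m_{j_1},\dots,m_{j_l})$, $w(f)=m_{j_1}\cdots m_{j_l}$, $m(f)=\max_z m_{j_z}$. (These need not be uniquely determined by $f$; the notation means that $f$ admits such a representation, which is fixed while working with $f$.) The same conventions apply to the representations below. Given $W_k$, $k\ge1$: (A) $f_1<\dots<f_d$ in $W_k$ are $(n,\lambda)$-packed, $\lambda\in\overline{\mathcal D}$, if they are $S_n$-admissible,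 and for $2\le i\le d$: $w(f_i)\ge2^{\max\mathrm{supp}(f_{i-1})}$ and $d(m(f_i),\lambda)\le2^{-\max\mathrm{supp}(f_{i-1})}$. If in addition $\max_{1\le i\le d}d(m(f_i),\lambda)\le\eta$, they are $(n,\lambda,\eta)$-packed. (B) Inductively for $l\ge2$, $f_1<\dots<f_d$ in $W_k$ are $(n_{j_1},\dots,n_{j_l},\lambda)$-packed if: (1) $w(f_i)\ge2^{\max\mathrm{supp}(f_{i-1})}$ for $2\le i\le d$; (2) there is a partition $F_1<\dots<F_M$ of $\{1,\dots,d\}$ with $\{f_{\min F_k}\}_{k=1}^M$ $S_{n_{j_l}}$-admissible; (3) there are $\lambda_1,\dots,\lambda_M\in\overline{\mathcal D}$ such that $(f_i)_{i\in F_1}$ is $(n_{j_1},\dots,n_{j_{l-1}},\lambda_1)$-packed, and for $2\le k\le M$, $(f_i)_{i\in F_k}$ is $(n_{j_1},\dots,n_{j_{l-1}},\lambda_k,2^{-\max\mathrm{supp}(f_{\max F_{k-1}})})$-packed and $d(\lambda_k,\lambda)\le2^{-\max\mathrm{supp}(f_{\max F_{k-1}})}$. If in addition $\max_i d(m(f_i),\lambda)\le\eta$, they are $(n_{j_1},\dots,n_{j_l},\lambda,\eta)$-packed. $W_{k+1}$ is $W_k$ together with all $f=\frac1{m_{j_1}\cdots m_{j_l}}\sum_{i=1}^df_i$ where $f_1<\dots<f_d$ in $W_k$ are $(n_{j_1},\dots,n_{j_l},\lambda)$-packed for some $\lambda\in\overline{\mathcal D}$; again $\vec w(f)=(m_{j_1},\dots,m_{j_l})$,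 $w(f)=m_{j_1}\cdots m_{j_l}$, $m(f)=\max_zm_{j_z}$. $W=\bigcup_{k\ge0}W_k$, and $X_{\mathcal D}$ is the completion of $c_{00}$ under $\|x\|=\sup\{f(x):f\in W\}$. *)

(* Defs.v *)
From HB Require Import structures.
From mathcomp Require Import all_boot all_order all_algebra finmap.
From mathcomp Require Import all_classical all_reals all_analysis.
Set Implicit Arguments.
Unset Strict Implicit.
Unset Printing Implicit Defensive.
Import Order.TTheory GRing.Theory Num.Theory numFieldNormedType.Exports.
Local Open Scope classical_set_scope.
Local Open Scope ring_scope.

(* ** Schreier families

   N starts at 1, and 0 belongs to no member of a Schreier family. All members
   are nonempty, as min F has to make sense. *)

Definition fset_before (A B : {fset nat}) : Prop :=
  forall a b, a \in A -> b \in B -> (a < b)%N.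

(* k <= min F, for nonempty F *)
Definition le_min (k : nat) (F : {fset nat}) : Prop :=
  forall i, i \in F -> (k <= i)%N.

Fixpoint schreier (n : nat) (F : {fset nat}) : Prop :=
  match n with
  | 0 => exists2 i, (0 < i)%N & F = [fset i]%fset
  | 1 => F <> fset0 /\ le_min #|` F| F
  | n'.+1 => exists2 s : seq {fset nat},
      [/\ s <> [::],
          le_min (size s) (head fset0 s),
          forall p q, (p < q < size s)%N ->
            fset_before (nth fset0 s p) (nth fset0 s q) &
          forall p, (p < size s)%N -> schreier n' (nth fset0 s p)] &
      F = (\bigcup_(A <- s) A)%fset
  end.

(* ** Finitely supported vectors

   A vector is a function on nat whose coordinates of interest are the i >= 1;
   coordinate 0 is required to vanish. *)

Definition support {R : realType} (x : nat -> R) : set nat := [set i | x i != 0].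

Definition c00 {R : realType} (x : nat -> R) : Prop :=
  x 0%N = 0 /\ finite_set (support x).

(* minsupp and maxsupp are only meaningful for nonzero vectors of c00. *)
Definition minsupp {R : realType} (x : nat -> R) : nat :=
  xget 0%N [set i | support x i /\ forall k, support x k -> (i <= k)%N].

Definition maxsupp {R : realType} (x : nat -> R) : nat :=
  xget 0%N [set i | support x i /\ forall k, support x k -> (k <= i)%N].

Definition before {R : realType} (x y : nat -> R) : Prop :=
  forall i k, support x i -> support y k -> (i < k)%N.

Definition block_sequence {R : realType} (x : nat -> nat -> R) : Prop :=
  (forall r, c00 (x r) /\ x r <> 0) /\
  (forall r s, (r < s)%N -> before (x r) (x s)).

(* To be used for (finite) sequences of successive nonzero vectors. *)
Definition admissible {R : realType} (n : nat) (xs : seq (nat -> R)) : Prop :=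
  schreier n [fset i in [seq minsupp x | x <- xs]]%fset.

(* The unit vector e_i; e_i^* is the same function, through pairing. *)
Definition unit_vec {R : realType} (i : nat) : nat -> R :=
  fun k => (k == i)%:R.

(* The sum over all i has finitely many nonzero terms when f or x is in c00. *)
Definition pairing {R : realType} (f x : nat -> R) : R :=
  \sum_(i \in [set: nat]) f i * x i.

(* ** The binary tree and its completion *)

Definition node := seq bool.

Definition meet_height (s t : node) : nat :=
  (\max_(h < (size s).+1 | prefix (take h s) t) h)%N.

Definition dist {R : realType} (s t : node) : R :=
  if s == t then 0 else 2 ^- meet_height s t.

(* {0,1}^h in lexicographic order *)
Fixpoint words (h : nat) : seq node :=
  if h is h'.+1 then [seq b :: w | b <- [:: false; true], w <- words h']
  else [:: [::]].

(* phi j is the node attached to m_j if j >= 1, and phi 0 the one attached to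
   infinity: all nodes are listed by height, lexicographically within each
   height (the levels 0, ..., j contain at least j + 1 nodes). *)
Definition phi (j : nat) : node :=
  nth [::] (flatten [seq words h | h <- iota 0 j.+1]) j.

(* The completion of the tree: Cauchy sequences of nodes, at distance the limit
   of the termwise distances. Sequences at distance 0 are not identified, which
   is immaterial as points of the completion are only used through distances. *)
Record dbar (R : realType) := Dbar {
  dseq :> nat -> node;
  dseq_cauchy : forall e : R, 0 < e ->
    exists N, forall p q, (N <= p)%N -> (N <= q)%N ->
      dist (dseq p) (dseq q) < e }.

Definition dist_dbar {R : realType} (u v : dbar R) : R :=
  limn (fun k => dist (u k) (v k) : R).

Lemma cst_cauchy (R : realType) (s : node) (e : R) : 0 < e ->
  exists N, forall p q, (N <= p)%N -> (N <= q)%N ->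
    dist ((fun=> s) p) ((fun=> s) q) < e.
Proof. by move=> e0; exists 0%N => p q _ _; rewrite /dist eqxx. Qed.

Definition of_node (R : realType) (s : node) : dbar R :=
  Dbar (@cst_cauchy R s).

(* ** The norming set *)

(* A functional together with a fixed representation: vw is the list
   [:: j_1; ...; j_l] of the indices of its vector weight (m_{j_1}, ..., m_{j_l});
   the empty list is used for the functionals +- e_i^*. *)
Record wfun (R : realType) := Wfun { vw : seq nat; fn :> nat -> R }.

Definition wfun0 (R : realType) : wfun R := Wfun [::] 0.

Definition weight {R : realType} (m : nat -> nat) (f : wfun R) : \bar R :=
  if vw f is [::] then +oo%E else ((\prod_(j <- vw f) m j)%N%:R)%:E.

(* The index of m(f) = max_z m_{j_z}, which is max_z j_z as m increases;
   0 is the index of infinity. *)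
Definition mindex {R : realType} (f : wfun R) : nat := (\max_(j <- vw f) j)%N.

(* d(m(f), lam) *)
Definition dist_m {R : realType} (f : wfun R) (lam : dbar R) : R :=
  dist_dbar (of_node R (phi (mindex f))) lam.

Definition successive {R : realType} (fs : seq (wfun R)) : Prop :=
  forall p q, (p < q < size fs)%N ->
    before (nth (wfun0 R) fs p) (nth (wfun0 R) fs q).

Definition fast_weights {R : realType} (m : nat -> nat) (fs : seq (wfun R)) :
    Prop :=
  forall i, (0 < i < size fs)%N ->
    ((2 ^+ maxsupp (nth (wfun0 R) fs i.-1))%:E
       <= weight m (nth (wfun0 R) fs i))%E.

(* max_i d(m(f_i), lam) <= eta *)
Definition near_node {R : realType} (lam : dbar R) (eta : R)
    (fs : seq (wfun R)) : Prop :=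
  forall i, (i < size fs)%N -> dist_m (nth (wfun0 R) fs i) lam <= eta.

(* packed m n [:: j_1; ...; j_l] lam fs: the sequence fs is
   (n_{j_1}, ..., n_{j_l}, lam)-packed. In the inductive clause, the partition
   F_1 < ... < F_M of the index set of fs is given by the list
   ff = [:: (f_i)_{i in F_1}; ...; (f_i)_{i in F_M}]. *)
Inductive packed {R : realType} (m n : nat -> nat) :
    seq nat -> dbar R -> seq (wfun R) -> Prop :=
| packed_one (j : nat) (lam : dbar R) (fs : seq (wfun R)) :
    successive fs ->
    admissible (n j) [seq fn f | f <- fs] ->
    fast_weights m fs ->
    (forall i, (0 < i < size fs)%N ->
       dist_m (nth (wfun0 R) fs i) lam
         <= 2 ^- maxsupp (nth (wfun0 R) fs i.-1)) ->
    packed m n [:: j] lam fs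
| packed_rcons (js : seq nat) (j : nat) (lam : dbar R)
    (ff : seq (seq (wfun R))) (lams : nat -> dbar R) :
    js <> [::] ->
    successive (flatten ff) ->
    fast_weights m (flatten ff) ->
    (forall k, (k < size ff)%N -> nth [::] ff k <> [::]) ->
    admissible (n j) [seq fn (head (wfun0 R) F) | F <- ff] ->
    (forall k, (k < size ff)%N -> packed m n js (lams k) (nth [::] ff k)) ->
    (forall k, (0 < k < size ff)%N ->
       let eta := 2 ^- maxsupp (last (wfun0 R) (nth [::] ff k.-1)) in
       near_node (lams k) eta (nth [::] ff k) /\
       dist_dbar (lams k) lam <= eta) ->
    packed m n (rcons js j) lam (flatten ff).

Definition W_zero {R : realType} : set (wfun R) :=
  [set f | vw f = [::] /\
     exists2 i, (0 < i)%N & fn f = unit_vec i \/ fn f = - unit_vec i].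

Definition positive_indices (js : seq nat) : bool :=
  (js != [::]) && all (fun j => 0 < j)%N js.

Definition W_schreier {R : realType} (m n : nat -> nat) : set (wfun R) :=
  [set f | positive_indices (vw f) /\
     exists2 F : {fset nat}, schreier (\sum_(j <- vw f) n j)%N F &
       fn f = (\prod_(j <- vw f) m j)%N%:R^-1 *:
                \sum_(i <- F) (unit_vec i : nat -> R)].

Definition W_packed {R : realType} (m n : nat -> nat) (V : set (wfun R)) :
    set (wfun R) :=
  [set f | positive_indices (vw f) /\
     exists (lam : dbar R) (fs : seq (wfun R)),
       [/\ forall i, (i < size fs)%N -> V (nth (wfun0 R) fs i),
           packed m n (vw f) lam fs &
           fn f = (\prod_(j <- vw f) m j)%N%:R^-1 *: \sum_(g <- fs) fn g]].

Fixpoint W_level {R : realType} (m n : nat -> nat) (k : nat) : set (wfun R) :=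
  match k with
  | 0 => W_zero
  | 1 => W_zero `|` W_schreier m n
  | k'.+1 => W_level m n k' `|` W_packed m n (W_level m n k')
  end.

Definition W {R : realType} (m n : nat -> nat) : set (nat -> R) :=
  [set fn f | f in \bigcup_k W_level m n k].

(* The norm of X_D on c00. Every f in W has coordinates in [-1, 1], so that the
   supremum is taken over a set bounded by the l1 norm of x. *)
Definition normX {R : realType} (m n : nat -> nat) (x : nat -> R) : R :=
  sup [set pairing f x | f in W m n].

(* Sequences are indexed from 1: the values m 0 and n 0 are irrelevant. *)
Record parameters (R : realType) (m n : nat -> nat) : Prop := {
  m_increasing : forall i j, (0 < i < j)%N -> (m i < m j)%N;
  n_increasing : forall i j, (0 < i < j)%N -> (n i < n j)%N;
  m_one : m 1%N = 100%N;
  n_one : n 1%N = 1%N;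
  m_growth : forall j, (0 < j)%N -> (j ^ 2 * m j ^ 2 <= m j.+1)%N;
  n_growth : forall j, (0 < j)%N ->
    4 / ln 100 * (n j)%:R * ln (m j.+1)%:R < (n j.+1)%:R :> R }.

(* Main.v *)
(** Take f_r in W with support in supp x_r and f_r(x_r) >= 0.99, and pass to a
    subsequence. If the weights of the f_r are unbounded, one may assume that
    they increase fast and, by compactness of the completed tree, that the m(f_r)
    converge fast to a point lambda; then signed f_r are (n_{j_0}, lambda)-packed.
    Otherwise all f_r may be assumed to have the same weight vector
    (m_{j_1}, ..., m_{j_l}), and one would like their components to form an
    (n_{j_1}, ..., n_{j_l}, n_{j_0})-packed sequence. The components of the first
    block of f_r obstruct this, as packing does not constrain their distance to
    the point lambda_r of f_r, so they are dropped. What is lost is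
    h_r(x_r) / m_{j_l} <= 1/100 for some h_r in W; to keep 0.99 exactly, start from
    f_r(x_r) very close to 1, and if the loss is too large replace f_r by h_r, which
    then almost norms x_r and has a smaller support. *)

Require Import Defs.
From HB Require Import structures.
From mathcomp Require Import all_boot all_order all_algebra finmap.
From mathcomp Require Import lra.
From mathcomp Require Import all_classical all_reals all_analysis.
Import Order.TTheory GRing.Theory Num.Theory numFieldNormedType.Exports.
(* Again, as ssralg shadows support. *)
Import Defs.
Set Implicit Arguments.
Unset Strict Implicit.
Unset Printing Implicit Defensive.
Local Open Scope classical_set_scope.
Local Open Scope ring_scope.

(** * Schreier families *)

(** The replacement of f_r by h_r terminates because the tolerance depends on the support: when supp
    f_r lies below B, one asks for f_r(x_r) >= 1 - 100^-(B+1). If what is kept is worth less than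
    0.99, then h_r(x_r) / m_{j_l} > 1/100 - 100^-(B+1), hence h_r(x_r) >= 1 - 100^-B as m_{j_l} >=
    100. Since supp h_r lies below B - 1, this is again the required tolerance.

    What survives of f_r has components of weight at least 2^N, at distance at most 2^-N from
    lambda_r, for some N in supp x_r. This N exceeds all of supp x_s for s < r, so the survivors of
    different r fit together, each family with its own point lambda_r, as soon as the lambda_r
    converge fast.

    Omega is selected through weights and distances only, so it serves all j_0 at once; j_0 enters
    through admissibility, which is inherited by spreading from the minima of the x_r. *)

Lemma choice_cond (T U : Type) (D : T -> Prop) (Q : T -> U -> Prop) (u0 : U) :
  (forall x, D x -> exists y, Q x y) ->
  exists f : T -> U, forall x, D x -> Q x (f x).
Proof.
move=> h; have /choice[f hf] : forall x, exists y, D x -> Q x y; last by exists f.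
by move=> x; have [/h[y]|nD] := pselect (D x); [exists y|exists u0].
Qed.

Lemma schreier_neq0 (n : nat) (F : {fset nat}) : schreier n F -> F <> fset0.
Proof.
elim: n F => [|[|n] IH] F /=; first by case=> i _ -> /fsetP/(_ i); rewrite !inE eqxx.
  by case.
case=> [[|A s] [s0 _ _ hs]] -> /fsetP E; first by [].
have /IH /eqP/fset0Pn [a aA] := hs 0%N isT.
by have := E a; rewrite big_cons in_fsetU aA.
Qed.

Definition sorted_elts (A : {fset nat}) : seq nat := sort leq A.

Lemma mem_sorted_elts (A : {fset nat}) : sorted_elts A =i A.
Proof. by move=> i; rewrite mem_sort. Qed.

Lemma sorted_elts_ltn (A : {fset nat}) : sorted ltn (sorted_elts A).
Proof.
by rewrite ltn_sorted_uniq_leq sort_uniq fset_uniq; apply: sort_sorted leq_total _.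
Qed.

Lemma size_sorted_elts (A : {fset nat}) : size (sorted_elts A) = #|` A|.
Proof. exact: size_sort. Qed.

Definition fset_beforeb (A B : {fset nat}) : bool := `[< fset_before A B >].

(* The defining clause of S_{n+1} also describes S_1 in terms of S_0. *)
Lemma schreierS (n : nat) (F : {fset nat}) :
  schreier n.+1 F <->
  exists s : seq {fset nat},
    [/\ s <> [::], pairwise fset_beforeb s,
        forall A, A \in s -> schreier n A,
        forall i, i \in F -> (size s <= i)%N &
        F = (\bigcup_(A <- s) A)%fset].
Proof.
split.
  case: n => [|n].
    case=> F0 Fm; exists [seq [fset i]%fset | i <- sorted_elts F].
    split.
    - move=> /(congr1 size); rewrite size_map size_sorted_elts /=.
      by move/eqP; rewrite cardfs_eq0 => /eqP.
    - rewrite pairwise_map; apply: sub_pairwise (_ : pairwise ltn _).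
        move=> i j /= ij; apply/asboolP => a b; rewrite !inE => /eqP -> /eqP -> //.
      by rewrite -sorted_pairwise; [exact: sorted_elts_ltn|exact: ltn_trans].
    - move=> A /mapP[i]; rewrite mem_sorted_elts => iF ->; exists i => //.
      by apply: leq_trans (Fm _ iF); rewrite cardfs_gt0; apply/eqP.
    - by move=> i iF; rewrite size_map size_sorted_elts; exact: Fm.
    apply/fsetP => i; apply/idP/bigfcupP => [iF|[A]].
      by exists [fset i]%fset; rewrite ?inE// andbT map_f// mem_sorted_elts.
    by rewrite andbT => /mapP[j]; rewrite mem_sorted_elts => jF ->;
      rewrite inE => /eqP ->.
  case=> s [s0 smin sbef sch] FE; exists s; split => //.
  - apply/(pairwiseP fset0) => p q ps qs pq; apply/asboolP; apply: sbef.
    by rewrite pq.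
  - by move=> A /(nthP fset0)[p ps <-]; exact: sch.
  move=> i; rewrite {}FE => /bigfcupP[A]; rewrite andbT => /(nthP fset0)[p ps <-].
  case: p ps => [|p] ps iA; first by apply: smin; rewrite -nth0.
  have s00 : (0 < size s)%N by apply: leq_trans ps.
  have /eqP/fset0Pn [a aA] := @schreier_neq0 n.+1 _ (sch _ s00).
  apply: (@leq_trans a); first by apply: smin; rewrite -nth0.
  by apply: ltnW; apply: (sbef 0%N p.+1).
case=> s [s0 sbef sch smin FE].
have hd : {subset head fset0 s <= F}.
  case: s s0 FE {sbef sch smin} => //= A s _ -> i iA; rewrite big_cons in_fsetU.
  by rewrite iA.
case: n sch => [|n] sch.
  have cF : (#|` F| <= size s)%N.
    rewrite FE; elim: s sch {s0 sbef smin FE hd} => [|A s IH] sch.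
      by rewrite big_nil cardfs0.
    rewrite big_cons; have [i _ ->] := sch A (mem_head _ _).
    rewrite cardfsU cardfs1 /=; apply: leq_trans (leq_subr _ _) _.
    by rewrite add1n ltnS; apply: IH => B Bs; apply: sch; rewrite inE Bs orbT.
  split; last by move=> i iF; apply: leq_trans cF (smin _ iF).
  have hs : schreier 0 (head fset0 s).
    by apply: sch; case: s s0 {sbef smin FE hd cF} => //= A s _; rewrite mem_head.
  by have /eqP/fset0Pn[a /hd aF] := schreier_neq0 hs => F0; rewrite F0 inE in aF.
exists s => //; split => //.
- by move=> i /hd; exact: smin.
- move=> p q /andP[pq qs]; apply/asboolP.
  by apply: (pairwiseP fset0 sbef) => //; rewrite inE (ltn_trans pq).
- by move=> p ps; apply: sch; rewrite mem_nth.
Qed.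

Lemma schreier_gt0 (n : nat) (F : {fset nat}) i : schreier n F -> i \in F -> (0 < i)%N.
Proof.
case: n => [[j j0 ->]|n /schreierS[s [s0 _ _ smin _]]]; first by rewrite inE => /eqP ->.
by move=> /smin; apply: leq_trans; case: s s0 {smin}.
Qed.

(** Pulling a decomposition of F back along h and discarding the empty preimages leaves no more
    pieces than before, and the elements of G lie to the right of their images, so the bound on the
    number of pieces persists. *)
Lemma schreier_spread_map (n : nat) (F G : {fset nat}) (h : nat -> nat) :
  G <> fset0 -> {in G &, {homo h : i j / (i < j)%N}} ->
  (forall i, i \in G -> h i \in F /\ (h i <= i)%N) ->
  schreier n F -> schreier n G.
Proof.
elim: n F G => [|n IH] F G G0 hinc hF.
  case=> i i0 FE; have /eqP/fset0Pn[g gG] := G0; exists g.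
    by have [] := hF _ gG; rewrite FE inE => /eqP -> /(leq_trans i0).
  apply/fsetP => k; rewrite inE; apply/idP/eqP => [kG|-> //].
  have [+ _] := hF _ gG; have [+ _] := hF _ kG; rewrite FE !inE => /eqP hk /eqP hg.
  case: (ltngtP k g) => // /hinc; first by move=> /(_ kG gG); rewrite hk hg ltnn.
  by move=> /(_ gG kG); rewrite hk hg ltnn.
move=> /schreierS[s [s0 sbef sch smin FE]]; apply/schreierS.
pose pb (A : {fset nat}) := [fset i in G | h i \in A]%fset.
have GE i : i \in G -> exists2 A, A \in s & i \in pb A.
  move=> iG; have [+ _] := hF _ iG; rewrite FE => /bigfcupP[A].
  by rewrite andbT => As hA; exists A; rewrite // !inE iG.
exists [seq A <- map pb s | A != fset0]; split.
- have /eqP/fset0Pn[g /GE[A As gA]] := G0.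
  move=> /(congr1 (fun s : seq _ => pb A \in s)).
  by rewrite mem_filter map_f// andbT in_nil => /negbFE /eqP E; rewrite E inE in gA.
- apply: pairwise_filter; rewrite pairwise_map; apply: sub_pairwise sbef.
  move=> A B /asboolP AB; apply/asboolP => a b.
  rewrite !inE => /andP[aG /AB ha] /andP[bG /ha hab].
  by rewrite ltnNge leq_eqVlt; apply/negP => /orP[/eqP E|/hinc];
    [rewrite E ltnn in hab|move=> /(_ bG aG) /ltn_trans /(_ hab); rewrite ltnn].
- move=> B; rewrite mem_filter => /andP[/eqP B0 /mapP[A As E]]; subst B.
  apply: (IH A) => //; first 2 last.
  + exact: sch.
  + by move=> i j; rewrite !inE => /andP[iG _] /andP[jG _]; apply: hinc.
  + by move=> i; rewrite !inE => /andP[iG hi]; have [] := hF _ iG.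
- move=> i iG; have [/smin hi] := hF _ iG; apply: leq_trans.
  by apply: leq_trans hi; rewrite size_filter -(size_map pb); exact: count_size.
apply/fsetP => i; apply/idP/bigfcupP => [iG|[B]].
  have [A As iA] := GE _ iG; exists (pb A) => //.
  rewrite andbT mem_filter map_f// andbT; apply/eqP => E.
  by rewrite E inE in iA.
by rewrite andbT mem_filter => /andP[_ /mapP[A _ ->]]; rewrite !inE => /andP[].
Qed.

(* Heredity and spreading at once: G interlaces with F, so that the largest
   element of F below i depends on i in G in a strictly increasing way. *)
Lemma schreier_interlace (n : nat) (F G : {fset nat}) :
  G <> fset0 ->
  (forall j, j \in G -> exists2 f, f \in F & (f <= j)%N) ->
  (forall i j, i \in G -> j \in G -> (i < j)%N ->
     exists2 f, f \in F & (i < f <= j)%N) ->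
  schreier n F -> schreier n G.
Proof.
move=> G0 h1 h2.
pose h i := (\max_(f <- F | (f <= i)%N) f)%N.
have hle i f : f \in F -> (f <= i)%N -> (f <= h i)%N.
  by move=> fF fi; rewrite /h (big_rem f)//= fi leq_maxl.
have hin i : i \in G -> h i \in F /\ (h i <= i)%N.
  move=> iG; have [f0 f0F f0i] := h1 _ iG.
  (* An empty maximum would be 0 by default; if h i = 0, the element of F below i given by [h1] is 0
     itself. *)
  have : h i = 0%N \/ h i \in F /\ (h i <= i)%N.
    rewrite /h big_seq_cond; apply: (big_ind (fun k => k = 0%N \/ k \in F /\ (k <= i)%N)).
    - by left.
    - move=> a b [->|ha] [->|hb]; rewrite ?max0n ?maxn0; [by left|by right|by right|].
      by rewrite /maxn; case: ifP => _; right.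
    - by move=> k /andP[]; right.
  case=> // hi0; have := hle _ _ f0F f0i; rewrite hi0 leqn0 => /eqP f00.
  by rewrite -{1}f00.
apply: (@schreier_spread_map n F G h) => // i j iG jG ij.
have [f fF /andP[fi fj]] := h2 _ _ iG jG ij.
by have [_ hi] := hin _ iG; apply: (leq_ltn_trans hi);
  apply: leq_trans fi (hle _ _ fF fj).
Qed.

Lemma fset_before_sorted (s : seq {fset nat}) :
  pairwise fset_beforeb s ->
  sorted ltn (flatten [seq sorted_elts A | A <- s]).
Proof.
rewrite sorted_pairwise; last exact: ltn_trans.
elim: s => [//|A s IH] /=; rewrite pairwise_cat => /andP[/allP As /IH ->].
rewrite andbT; apply/andP; split.
  apply/allrelP => a b; rewrite mem_sorted_elts => aA /flattenP[t /mapP[B Bs ->]].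
  by rewrite mem_sorted_elts => bB; have /asboolP := As _ Bs; apply.
by rewrite -sorted_pairwise; [exact: sorted_elts_ltn|exact: ltn_trans].
Qed.

Lemma fset_sorted_elts (A : {fset nat}) : [fset i in sorted_elts A]%fset = A.
Proof. by apply/fsetP => i; rewrite !inE/= mem_sorted_elts. Qed.

(** Induction on b: cut t into its S_{a+b} pieces and split each of them. The minima of the
    resulting parts are elements of t, hence at least the number of cuts. This provides the
    partition that packing demands where only an S_{a+b} condition is known. *)
Lemma schreier_convolution (a b : nat) (t : seq nat) :
  sorted ltn t -> schreier (a + b) [fset i in t]%fset ->
  exists tt : seq (seq nat),
    [/\ t = flatten tt,
        forall u, u \in tt -> u <> [::] /\ schreier a [fset i in u]%fset &
        schreier b [fset i in [seq head 0%N u | u <- tt]]%fset].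
Proof.
elim: b t => [|b IH] t srt.
  rewrite addn0 => sch; exists [:: t]; rewrite /= cats0; split => //.
    move=> u; rewrite inE => /eqP ->; split => // t0.
    by apply: schreier_neq0 sch _; rewrite t0; apply/fsetP => i; rewrite !inE.
  have t0 : t <> [::].
    by move=> t0; apply: schreier_neq0 sch _; rewrite t0; apply/fsetP => i; rewrite !inE.
  exists (head 0%N t).
    apply: schreier_gt0 sch _; rewrite !inE /=.
    by case: t t0 {srt} => //= i t _; rewrite mem_head.
  by apply/fsetP => i; rewrite !inE /= orbF.
rewrite addnS => /schreierS[s [s0 sbef sch smin FE]].
have tE : t = flatten [seq sorted_elts A | A <- s].
  apply: (irr_sorted_eq ltn_trans ltnn srt (fset_before_sorted sbef)) => i.
  have -> : (i \in t) = (i \in [fset i in t]%fset) by rewrite !inE.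
  rewrite FE; apply/bigfcupP/flattenP => [[A]|[u /mapP[A As ->]]].
    rewrite andbT => As iA; exists (sorted_elts A); rewrite ?mem_sorted_elts//.
    exact: map_f.
  by rewrite mem_sorted_elts => iA; exists A; rewrite ?As.
pose Q A tt := [/\ sorted_elts A = flatten tt,
    forall u, u \in tt -> u <> [::] /\ schreier a [fset i in u]%fset &
    schreier b [fset i in [seq head 0%N u | u <- tt]]%fset].
have /(choice_cond [::])[ttf httf] : forall A, A \in s -> exists tt, Q A tt.
  move=> A As; apply: IH; last by rewrite fset_sorted_elts; apply: sch.
  exact: sorted_elts_ltn.
exists (flatten [seq ttf A | A <- s]); split.
- rewrite tE; elim: s httf {s0 sbef sch smin FE tE} => //= A s IHs httf.
  rewrite flatten_cat IHs; last by move=> B Bs; apply: httf; rewrite inE Bs orbT.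
  by have [-> _ _] := httf A (mem_head _ _).
- move=> u /flattenP[v /mapP[A As ->]]; by have [_ + _] := httf A As; apply.
have hdA A i : A \in s -> i \in [seq head 0%N u | u <- ttf A] -> i \in A.
  move=> As /mapP[u uA ->]; have [sE /(_ u uA)[u0 _] _] := httf A As.
  have : head 0%N u \in sorted_elts A.
    rewrite sE; apply/flattenP; exists u => //.
    by case: u u0 {uA sE} => //= x u _; rewrite mem_head.
  by rewrite mem_sorted_elts.
apply/schreierS.
exists [seq [fset i in [seq head 0%N u | u <- ttf A]]%fset | A <- s]; split.
- by case: s s0 {sbef sch smin FE tE httf hdA}.
- rewrite pairwise_map; apply: sub_in_pairwise (_ : all (mem s) s) sbef; last first.
    by apply/allP.
  move=> A B As Bs /= /asboolP AB; apply/asboolP => i j; rewrite !inE.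
  by move=> /(hdA _ _ As) iA /(hdA _ _ Bs); apply: AB.
- by move=> B /mapP[A As ->]; have [] := httf A As.
- move=> i; rewrite !inE size_map => /mapP[u /flattenP[v /mapP[A As ->]] uA ->].
  apply: smin; rewrite FE; apply/bigfcupP; exists A; rewrite ?As//.
  by apply: hdA => //; apply: map_f.
apply/fsetP => i; rewrite !inE; apply/mapP/bigfcupP.
  move=> [u /flattenP[v /mapP[A As ->]] uA ->].
  exists [fset i in [seq head 0%N u | u <- ttf A]]%fset; first by rewrite andbT map_f.
  by rewrite !inE map_f.
move=> [B]; rewrite andbT => /mapP[A As ->]; rewrite !inE => /mapP[u uA ->].
by exists u => //; apply/flattenP; exists (ttf A) => //; apply: map_f.
Qed.

(** * Packed sequences in pairwise form *)

HB.instance Definition _ (R : realType) := gen_eqMixin (wfun R).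
HB.instance Definition _ (R : realType) := gen_eqMixin (dbar R).

Lemma support_neq0 (R : realType) (x : nat -> R) :
  x <> 0 -> exists i, support x i.
Proof.
move=> x0; apply: contrapT => h; apply: x0; apply/funext => i.
by apply: contrapT => /eqP xi; apply: h; exists i.
Qed.

Lemma minsuppP (R : realType) (x : nat -> R) : x <> 0 ->
  support x (minsupp x) /\ forall k, support x k -> (minsupp x <= k)%N.
Proof.
move=> /support_neq0 [i xi]; rewrite /minsupp.
have ex : exists i, `[< support x i >] by exists i; apply/asboolP.
apply: (@xgetPex _ 0%N [set i | support x i /\ forall k, support x k -> (i <= k)%N]).
case: (ex_minnP ex) => k /asboolP xk kmin.
by exists k; split => // l xl; apply: kmin; apply/asboolP.
Qed.

Lemma maxsuppP (R : realType) (x : nat -> R) : c00 x -> x <> 0 ->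
  support x (maxsupp x) /\ forall k, support x k -> (k <= maxsupp x)%N.
Proof.
move=> [_ xfin] /support_neq0 [i xi]; rewrite /maxsupp.
have ex : exists i, `[< support x i >] by exists i; apply/asboolP.
have [B /= xB] : exists B, forall k, support x k -> (k <= B)%N.
  exists (\max_(k <- fset_set (support x)) k)%N => k xk.
  by rewrite (big_rem k) ?leq_maxl// in_fset_set// inE.
have bd k : `[< support x k >] -> (k <= B)%N by move/asboolP; exact: xB.
apply: (@xgetPex _ 0%N [set i | support x i /\ forall k, support x k -> (k <= i)%N]).
case: (ex_maxnP ex bd) => k /asboolP xk kmax.
by exists k; split => // l xl; apply: kmax; apply/asboolP.
Qed.

Lemma minsupp0 (R : realType) : minsupp (0 : nat -> R) = 0%N.
Proof. by rewrite /minsupp; case: xgetP => // k _ [] /=; rewrite /support/= eqxx. Qed.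

Lemma minsupp_gt0_neq0 (R : realType) (x : nat -> R) : (0 < minsupp x)%N -> x <> 0.
Proof. by move=> + x0; rewrite x0 minsupp0. Qed.

Lemma before_maxsupp (R : realType) (x y : nat -> R) : c00 x -> x <> 0 -> c00 y ->
  y <> 0 -> before x y -> (maxsupp x < maxsupp y)%N.
Proof.
by move=> cx x0 cy y0; apply; [have [] := maxsuppP cx x0|have [] := maxsuppP cy y0].
Qed.

Notation pairwiseb P := (pairwise (fun x y => `[< P x y >])).

Lemma pairwise_flatten (T : Type) (r : rel T) (ss : seq (seq T)) :
  pairwise r (flatten ss) = pairwise (allrel r) ss && all (pairwise r) ss.
Proof.
elim: ss => //= s ss IH; rewrite pairwise_cat IH -!andbA.
have -> : allrel r s (flatten ss) = all (allrel r s) ss.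
  by elim: ss {IH} => [|t ss IH] /=; [exact: allrel0r|rewrite allrel_catr IH].
by congr (_ && _); rewrite andbCA.
Qed.

(** Since k grows along s, the condition relative to the immediate predecessor is the strongest one.
    The pairwise form passes to subsequences for free, which is why packing is handled through
    it. *)
Lemma chainP (T : Type) (x0 : T) (k : T -> nat) (Q : nat -> T -> Prop) (s : seq T) :
  (forall p q y, (p <= q)%N -> Q q y -> Q p y) ->
  pairwise (fun x y => (k x <= k y)%N) s ->
  (forall i, (0 < i < size s)%N -> Q (k (nth x0 s i.-1)) (nth x0 s i)) <->
  pairwiseb (fun x y => Q (k x) y) s.
Proof.
move=> Qmon /(pairwiseP x0) kmon; split.
  move=> h; apply/(pairwiseP x0) => p q ps qs pq; apply/asboolP.
  have q0 : (0 < q)%N by exact: leq_ltn_trans pq.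
  have := h q; rewrite q0 => /(_ qs); apply: Qmon.
  have : (p <= q.-1)%N by rewrite -ltnS prednK.
  rewrite leq_eqVlt => /orP[/eqP -> //|]; apply: kmon => //.
  by rewrite inE (leq_ltn_trans (leq_pred _)).
move=> /(pairwiseP x0) h i /andP[i0 si]; apply/asboolP; apply: h => //.
  by rewrite inE (leq_ltn_trans (leq_pred _)).
by rewrite prednK.
Qed.

Lemma pairwise_and (T : eqType) (P Q : T -> T -> Prop) (s : seq T) :
  pairwiseb (fun x y => P x y /\ Q x y) s <-> pairwiseb P s /\ pairwiseb Q s.
Proof.
elim: s => //= x s IH; split.
  move=> /andP[/allP h /IH[-> ->]].
  by rewrite !andbT; split; apply/allP=> y /h /asboolP[? ?]; apply/asboolP.
case=> /andP[/allP h ?] /andP[/allP h' ?]; apply/andP; split; last exact/IH.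
by apply/allP => y ys; apply/asboolP; split; apply/asboolP; [apply: h|apply: h'].
Qed.

Lemma all_nth (T : eqType) (x0 : T) (P : T -> Prop) (s : seq T) :
  (forall i, (i < size s)%N -> P (nth x0 s i)) <-> (forall y, y \in s -> P y).
Proof.
split=> [h y /(nthP x0)[i /h + <-] //|h i si].
by apply: h; rewrite mem_nth.
Qed.

Definition linked (R : realType) (m : nat -> nat) (f g : wfun R) : Prop :=
  before f g /\ ((2 ^+ maxsupp f)%:E <= weight m g)%E.

Definition near_past (R : realType) (lam : dbar R) (f g : wfun R) : Prop :=
  dist_m g lam <= 2 ^- maxsupp f.

Lemma expr2_le (R : realType) (p q : nat) : (p <= q)%N -> (2 ^+ p : R) <= 2 ^+ q.
Proof. by move=> pq; rewrite ler_weXn2l// ler1n. Qed.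

Lemma exprV2_le (R : realType) (p q : nat) : (p <= q)%N -> (2 ^- q : R) <= 2 ^- p.
Proof. by move=> pq; rewrite lef_pV2 ?posrE ?exprn_gt0// expr2_le. Qed.

Lemma successive_maxsupp (R : realType) (fs : seq (wfun R)) :
  (forall f, f \in fs -> c00 f /\ fn f <> 0) -> pairwiseb (fun f g : wfun R => before f
    g) fs ->
  pairwise (fun f g : wfun R => (maxsupp f <= maxsupp g)%N) fs.
Proof.
move=> h; apply: sub_in_pairwise (_ : all (mem fs) fs); last exact/allP.
move=> f g /h[cf f0] /h[cg g0] /asboolP fg; exact: ltnW (before_maxsupp cf f0 cg g0 fg).
Qed.

Lemma linkedP (R : realType) (m : nat -> nat) (fs : seq (wfun R)) :
  (forall f, f \in fs -> c00 f /\ fn f <> 0) ->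
  successive fs /\ fast_weights m fs <-> pairwiseb (linked m) fs.
Proof.
move=> h; rewrite pairwise_and.
have sucE : successive fs <-> pairwiseb (fun f g : wfun R => before f g) fs.
  split=> [hs|/(pairwiseP (wfun0 R)) hs p q /andP[pq qs]].
    by apply/(pairwiseP (wfun0 R)) => p q ps qs pq; apply/asboolP/hs; rewrite pq.
  by apply/asboolP/hs => //; rewrite inE (ltn_trans pq).
have fastE : pairwiseb (fun f g : wfun R => before f g) fs ->
    fast_weights m fs <->
    pairwiseb (fun f g : wfun R => ((2 ^+ maxsupp f)%:E <= weight m g)%E) fs.
  move=> /(successive_maxsupp h) hs.
  apply: (@chainP (wfun R) (wfun0 R) (fun f => maxsupp f)
    (fun k g => ((2 ^+ k)%:E <= weight m g)%E) fs _ hs) => p q g pq.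
  by apply: le_trans; rewrite lee_fin expr2_le.
split=> [[/sucE s] /(fastE s)|[s /(fastE s)]] //.
by split => //; apply/sucE.
Qed.

Lemma near_pastP (R : realType) (m : nat -> nat) (lam : dbar R) (fs : seq (wfun R)) :
  (forall f, f \in fs -> c00 f /\ fn f <> 0) -> pairwiseb (linked m) fs ->
  (forall i, (0 < i < size fs)%N ->
       dist_m (nth (wfun0 R) fs i) lam
         <= 2 ^- maxsupp (nth (wfun0 R) fs i.-1)) <->
  pairwiseb (near_past lam) fs.
Proof.
move=> h /pairwise_and[/(successive_maxsupp h) hs _].
apply: (@chainP (wfun R) (wfun0 R) (fun f => maxsupp f)
  (fun k g => dist_m g lam <= 2 ^- k) fs _ hs) => p q g pq.
by move=> /le_trans; apply; apply: exprV2_le.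
Qed.

Lemma admissible_minsupp_gt0 (R : realType) n (xs : seq (nat -> R)) x :
  admissible n xs -> x \in xs -> (0 < minsupp x)%N.
Proof.
by move=> /schreier_gt0 h xxs; apply: h; rewrite !inE/= map_f.
Qed.

Lemma admissible_neq_nil (R : realType) n (xs : seq (nat -> R)) :
  admissible n xs -> xs <> [::].
Proof.
by move=> /schreier_neq0 h x0; apply: h; rewrite x0; apply/fsetP => i; rewrite !inE.
Qed.

(** The zero vector has [minsupp] 0 by default, and Schreier sets contain positive integers only. *)
Lemma packed_neq0 (R : realType) (m n : nat -> nat) js (lam : dbar R) fs :
  packed m n js lam fs -> forall f, f \in fs -> fn f <> 0.
Proof.
elim=> {js lam fs} [j lam fs _ adm _ _ f ffs|js j lam ff lams _ _ _ _ _ _ IH _ f].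
  by apply: minsupp_gt0_neq0; apply: (admissible_minsupp_gt0 adm); apply: map_f.
by move=> /flattenP[F /(nthP [::])[k kff <-]]; exact: IH.
Qed.

(** A piece F_k of the partition, as the list of its functionals, with its point lambda_k. *)
Definition block (R : realType) : Type := (seq (wfun R) * dbar R)%type.

Definition near_blocks (R : realType) (lam : dbar R) (P Q : block R) : Prop :=
  forall f, f \in P.1 ->
    (forall g, g \in Q.1 -> dist_m g Q.2 <= 2 ^- maxsupp f) /\
    dist_dbar Q.2 lam <= 2 ^- maxsupp f.

(** The last functional of a block reaches furthest to the right, so its bound implies those
    relative to the others. Quantifying over the whole block survives the deletion of its last
    functional. *)
Lemma near_blocksP (R : realType) (m : nat -> nat) (lam : dbar R) (bl : seq (block R)) :
  (forall f, f \in flatten (unzip1 bl) -> c00 f /\ fn f <> 0) ->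
  pairwiseb (linked m) (flatten (unzip1 bl)) ->
  (forall P, P \in bl -> P.1 <> [::]) ->
  (forall k, (0 < k < size bl)%N ->
     let P := nth ([::], of_node R [::]) bl k.-1 in
     let Q := nth ([::], of_node R [::]) bl k in
     let eta := 2 ^- maxsupp (last (wfun0 R) P.1) in
     near_node Q.2 eta Q.1 /\ dist_dbar Q.2 lam <= eta) <->
  pairwiseb (near_blocks lam) bl.
Proof.
move=> h /pairwise_and[/(successive_maxsupp h) hs _] bl0.
move: (hs); rewrite pairwise_flatten => /andP[hbl hin].
have last_in P : P \in bl -> last (wfun0 R) P.1 \in P.1.
  by move=> /bl0; case: P => [[|f s] ?] //= _; rewrite mem_last.
pose Q (k : nat) (P : block R) :=
  near_node P.2 (2 ^- k) P.1 /\ dist_dbar P.2 lam <= 2 ^- k.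
transitivity (pairwiseb (fun P P' : block R => Q (maxsupp (last (wfun0 R) P.1)) P') bl).
  apply: (@chainP _ ([::], of_node R [::]) (fun P : block R => maxsupp (last (wfun0 R)
    P.1)) Q).
    move=> p q P pq [h1 h2]; split; last exact: le_trans h2 (exprV2_le _ pq).
    by move=> i /h1 /le_trans; apply; apply: exprV2_le.
  move: hbl; rewrite /unzip1 pairwise_map;
    apply: sub_in_pairwise (_ : all (mem bl) bl); last exact/allP.
  by move=> P P' Pb P'b /= /allrelP; apply; exact: last_in.
have lastmax P f : P \in bl -> f \in P.1 -> (maxsupp f <= maxsupp (last (wfun0 R) P.1))%N.
  move=> Pb; have /allP/(_ P.1) := hin; rewrite map_f// => /(_ isT).
  case: P {Pb} => s mu /=; case/lastP: s => [//|s g]; rewrite last_rcons pairwise_rcons.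
  by move=> /andP[/allP + _]; rewrite mem_rcons inE => + /orP[/eqP ->|fs]; [|apply].
split; apply: sub_in_pairwise (_ : all (mem bl) bl); try exact/allP.
  move=> P P' Pb _ /asboolP[h1 h2]; apply/asboolP => f fP; split.
    by move=> g /(nthP (wfun0 R))[i /h1 + <-] => /le_trans; apply;
      exact: exprV2_le (lastmax _ _ Pb fP).
  exact: le_trans h2 (exprV2_le _ (lastmax _ _ Pb fP)).
move=> P P' Pb _ /asboolP/(_ _ (last_in _ Pb))[h1 h2]; apply/asboolP; split => //.
exact: (all_nth (wfun0 R) (fun g => dist_m g P'.2 <= 2 ^- maxsupp (last (wfun0 R) P.1))
  P'.1).2 h1.
Qed.

(** Inversion of [packed] at its outermost level. The points lambda_k travel with their blocks, so
    blocks can be deleted or collected without reindexing. *)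
Inductive packed_spec (R : realType) (m n : nat -> nat) (lam : dbar R) (fs : seq (wfun
  R)) :
    seq nat -> Prop :=
| PackedOne j : admissible (n j) [seq fn f | f <- fs] ->
    pairwiseb (linked m) fs -> pairwiseb (near_past lam) fs ->
    packed_spec m n lam fs [:: j]
| PackedRcons js j (bl : seq (block R)) :
    js <> [::] -> fs = flatten (unzip1 bl) ->
    pairwiseb (linked m) fs ->
    (forall P, P \in bl -> P.1 <> [::] /\ packed m n js P.2 P.1) ->
    admissible (n j) [seq fn (head (wfun0 R) P.1) | P <- bl] ->
    pairwiseb (near_blocks lam) bl ->
    packed_spec m n lam fs (rcons js j).

Lemma packedP (R : realType) (m n : nat -> nat) (lam : dbar R) (fs : seq (wfun R)) js :
  (forall f, f \in fs -> c00 f) ->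
  packed m n js lam fs <-> packed_spec m n lam fs js.
Proof.
move=> cfs; split.
  move=> pk; have h f : f \in fs -> c00 f /\ fn f <> 0.
    by move=> ffs; split; [exact: cfs|exact: packed_neq0 pk _ ffs].
  case: pk h {cfs} => {js lam fs} [j lam fs suc adm fast dst|js j lam ff lams js0 suc
    fast ff0 adm pk dst] h.
    have /linkedP -/(_ h) lk := conj suc fast.
    by apply: PackedOne => //; apply/(near_pastP _ h lk).
  have /linkedP -/(_ h) lk := conj suc fast.
  pose bl : seq (block R) := zip ff (mkseq lams (size ff)).
  have szff : size bl = size ff by rewrite size_zip size_mkseq minnn.
  have bl1 : unzip1 bl = ff by rewrite unzip1_zip// size_mkseq.
  have blk k : (k < size ff)%N -> nth ([::], of_node R [::]) bl k = (nth [::] ff k,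
    lams k).
    by move=> kff; rewrite nth_zip ?size_mkseq// nth_mkseq.
  have blP (Q : block R -> Prop) : (forall k, (k < size ff)%N -> Q (nth [::] ff k, lams
    k)) ->
      forall P, P \in bl -> Q P.
    move=> hQ P /(nthP ([::], of_node R [::]))[k]; rewrite szff => kff <-.
    by rewrite blk//; apply: hQ.
  apply: (@PackedRcons _ _ _ _ _ _ _ bl) => //; rewrite ?bl1 //.
  - by apply: blP => k kff; split; [exact: ff0|exact: pk].
  - have -> // : [seq fn (head (wfun0 R) P.1) | P <- bl] = [seq fn (head (wfun0 R) F) |
    F <- ff].
    by rewrite -bl1 -map_comp.
  apply/(@near_blocksP _ m lam bl); rewrite ?bl1//.
    by apply: blP.
  move=> k; rewrite szff => /andP[k0 kff]; rewrite !blk//=.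
    by apply: dst; rewrite k0.
  exact: leq_ltn_trans (leq_pred _) kff.
case=> [j adm lk np|{}js j bl js0 E lk pk adm nb].
  have h f : f \in fs -> c00 f /\ fn f <> 0.
    move=> ffs; split; first exact: cfs.
    by apply: minsupp_gt0_neq0; apply: (admissible_minsupp_gt0 adm); apply: map_f.
  have [suc fast] := (linkedP m h).2 lk.
  by apply: packed_one => //; apply/(near_pastP _ h lk).
have h f : f \in fs -> c00 f /\ fn f <> 0.
  move=> ffs; split; first exact: cfs.
  move: ffs; rewrite E => /flattenP[F /mapP[P Pb ->] fP].
  by have [_ /packed_neq0] := pk _ Pb; apply.
have [suc fast] := (linkedP m h).2 lk.
rewrite E in suc fast h lk *.
have b0 P : P \in bl -> P.1 <> [::] by move=> /pk[].
have nb' := (near_blocksP lam h lk b0).2 nb.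
have nth1 k : (k < size bl)%N -> nth [::] (unzip1 bl) k = (nth ([::], of_node R [::])
  bl k).1.
  by move=> kb; rewrite (nth_map ([::], of_node R [::])).
apply: (@packed_rcons _ _ _ js j lam (unzip1 bl)
  (fun k => (nth ([::], of_node R [::]) bl k).2)) => //.
- by move=> k; rewrite size_map => kb; rewrite nth1//; apply: b0; rewrite mem_nth.
- by rewrite -map_comp.
- move=> k; rewrite size_map => kb; rewrite nth1//.
  by have [] := pk _ (mem_nth ([::], of_node R [::]) kb).
move=> k; rewrite size_map => /andP[k0 kb]; rewrite !nth1//.
  by apply: nb'; rewrite k0.
exact: leq_ltn_trans (leq_pred _) kb.
Qed.

(** * The completed tree *)

(** [take h] leaves shorter nodes unchanged, but distinct nodes with equal truncations both have
    length at least h, so their common truncation has height exactly h. *)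
Lemma meet_height_ge (h : nat) (s t : node) : s <> t ->
  (h <= meet_height s t)%N = (take h s == take h t).
Proof.
move=> st; case: h => [|h]; first by rewrite !take0 eqxx.
rewrite ltnNge; apply/idP/idP; last first.
  move=> /eqP E; apply/negP => /bigmax_leqP.
  have hs : (h < size s)%N.
    rewrite ltnNge; apply/negP => sh; apply: st.
    have sz : (size t <= h)%N.
      have : (size (take h.+1 t) <= h)%N by rewrite -E take_oversize// ltnW.
      by rewrite size_take_min geq_min ltnn.
    by move: E; rewrite !take_oversize// ltnW.
  by move=> /(_ (Ordinal (hs : (h.+1 < (size s).+1)%N))) /=;
    rewrite E prefix_take ltnn => /(_ isT).
apply: contraNT => /eqP E; apply/bigmax_leqP => -[i /= si].
rewrite prefixE size_takel// => /eqP it; rewrite leqNgt; apply/negP => hi; apply: E.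
by rewrite -(take_takel s hi) -(take_takel t hi) it.
Qed.

(** All radii in the packing conditions are powers 2^-h, so distance estimates become equalities of
    truncations; transitivity of equality is the ultrametric inequality. *)
Lemma dist_leP (R : realType) (h : nat) (s t : node) :
  (dist s t : R) <= 2 ^- h <-> take h s = take h t.
Proof.
rewrite /dist; case: eqP => [->|st]; first by split => // _; rewrite invr_ge0 exprn_ge0.
rewrite lef_pV2 ?posrE ?exprn_gt0// ler_eXn2l ?ltr1n// meet_height_ge//.
by split => /eqP.
Qed.

(** If the truncations differ, the nodes branch within their first N letters, and later letters do
    not affect the distance. *)
Lemma dist_take (R : realType) (N : nat) (s t : node) : take N s <> take N t ->
  dist s t = dist (take N s) (take N t) :> R.
Proof.
move=> st; rewrite /dist; case: eqP => [E|st']; first by rewrite E in st.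
case: eqP => // _; congr (2 ^- _).
suff E h : (h <= meet_height s t)%N = (h <= meet_height (take N s) (take N t))%N.
  by apply/eqP; rewrite eqn_leq -E leqnn E leqnn.
rewrite !meet_height_ge//; have [hN|Nh] := leqP h N; first by rewrite !take_takel.
rewrite [take h (take N s)]take_oversize; last first.
  by rewrite size_take_min geq_min ltnW.
rewrite [take h (take N t)]take_oversize; last first.
  by rewrite size_take_min geq_min ltnW.
apply/eqP/eqP => // E; exfalso; apply: st.
by rewrite -(take_takel s (ltnW Nh)) -(take_takel t (ltnW Nh)) E.
Qed.

Lemma exprV2_lt_eps (R : realType) (e : R) : 0 < e -> exists N, 2 ^- N < e.
Proof.
move=> e0; exists (Num.bound e^-1).
rewrite invf_plt ?posrE ?exprn_gt0//.
apply: lt_trans (archi_boundP _) _; first by rewrite invr_ge0 ltW.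
by rewrite -natrX ltr_nat ltn_expl.
Qed.

Definition eventually_eq (T : Type) (u v : nat -> T) : Prop :=
  exists K, forall k, (K <= k)%N -> u k = v k.

Definition agree (R : realType) (N : nat) (u v : dbar R) : Prop :=
  eventually_eq (fun k => take N (u k)) (fun k => take N (v k)).

Lemma dbar_stable (R : realType) (u : dbar R) (N : nat) :
  exists K, forall k, (K <= k)%N -> take N (u k) = take N (u K).
Proof.
have [|K hK] := @dseq_cauchy R u (2 ^- N); first by rewrite invr_gt0 exprn_gt0.
by exists K => k Kk; apply/(@dist_leP R)/ltW/hK.
Qed.

(** Both truncations stabilise, at different nodes, so the termwise distances are eventually
    constant and the limit is attained. *)
Lemma dist_dbar_disagree (R : realType) (N : nat) (u v : dbar R) : ~ agree N u v ->
  exists K, forall k, (K <= k)%N -> dist (u k) (v k) = dist_dbar u v.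
Proof.
move=> nuv; have [K hK] := dbar_stable u N; have [L hL] := dbar_stable v N.
have uv : take N (u K) <> take N (v L).
  move=> E; apply: nuv; exists (maxn K L) => k; rewrite geq_max => /andP[Kk Lk].
  by rewrite hK// hL.
have dE k : (maxn K L <= k)%N -> dist (u k) (v k) = dist (take N (u K)) (take N (v L))
  :> R.
  by rewrite geq_max => /andP[Kk Lk]; rewrite -(hK k)// -(hL k)//; apply: dist_take;
    rewrite hK ?hL.
exists (maxn K L) => k /dE ->; apply/esym; apply: lim_near_cst; first exact: Rhausdorff.
by exists (maxn K L).
Qed.

Lemma dist_dbar_leP (R : realType) (N : nat) (u v : dbar R) :
  dist_dbar u v <= 2 ^- N <-> agree N u v.
Proof.
split=> [uvN|[K hK]].
  apply: contrapT => nuv; have [K hK] := dist_dbar_disagree nuv.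
  by apply: nuv; exists K => k /hK E; apply/(@dist_leP R); rewrite E.
(* Either some truncation separates u and v, and the limit is attained, or none does and the limit
   is 0. *)
have [[M nuv]|al] := pselect (exists M, ~ agree M u v).
  have [L hL] := dist_dbar_disagree nuv.
  by rewrite -(hL (maxn K L)) ?leq_maxr//; apply/(@dist_leP R)/hK; rewrite leq_maxl.
suff -> : dist_dbar u v = 0 by rewrite invr_ge0 exprn_ge0.
apply: (cvg_lim (@Rhausdorff R)); apply/cvgrPdist_lt => e /exprV2_lt_eps[M Me].
have [L hL] : agree M u v by apply: contrapT => nuv; apply: al; exists M.
exists L => // k /hL /(@dist_leP R) h; rewrite sub0r normrN ger0_norm.
  exact: le_lt_trans Me.
by rewrite /dist; case: ifP => // _; rewrite invr_ge0 exprn_ge0.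
Qed.

Lemma agree_trans (R : realType) N (u v w : dbar R) :
  agree N u v -> agree N v w -> agree N u w.
Proof.
case=> K h [L h']; exists (maxn K L) => k; rewrite geq_max => /andP[/h -> /h' ->] //.
Qed.

Lemma dist_dbar_trans (R : realType) N (u v w : dbar R) :
  dist_dbar u v <= 2 ^- N -> dist_dbar v w <= 2 ^- N -> dist_dbar u w <= 2 ^- N.
Proof. by rewrite !dist_dbar_leP; exact: agree_trans. Qed.

Lemma dist_dbarxx (R : realType) N (u : dbar R) : dist_dbar u u <= 2 ^- N.
Proof. by rewrite dist_dbar_leP; exists 0%N. Qed.

Definition frequently (P : nat -> Prop) : Prop := forall K, exists2 r, (K <= r)%N & P r.

Lemma frequently_or (P Q : nat -> Prop) :
  frequently (fun r => P r \/ Q r) -> frequently P \/ frequently Q.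
Proof.
move=> h; have [|nP] := pselect (frequently P); first by left.
right => K; apply: contrapT => nQ; apply: nP => L; apply: contrapT => nP.
have [r] := h (maxn K L); rewrite geq_max => /andP[Kr Lr] [Pr|Qr].
  by apply: nP; exists r.
by apply: nQ; exists r.
Qed.

(** Compactness by Koenig's lemma: p h is a prefix shared, at height h, by infinitely many u r, and
    these prefixes extend one another. They may stop growing, in which case the cluster point is a
    node. *)
Lemma dbar_cluster (R : realType) (u : nat -> dbar R) :
  exists lam, forall N, frequently (fun r => dist_dbar (u r) lam <= 2 ^- N).
Proof.
pose above h p r := exists K, forall k, (K <= k)%N -> take h (u r k) = p.
pose I h p := frequently (above h p).
have step (hp : nat * node) : exists p', I hp.1 hp.2 -> take hp.1 p' = hp.2 /\ I
  hp.1.+1 p'.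
  case: hp => h p /=; have [Ip|nI] := pselect (I h p); last by exists [::].
  pose next q r := take h q = p /\ above h.+1 q r.
  (* The truncation of u r to length h + 1 either has one letter more than p, or is p itself because
     the branch stops there. *)
  have ext r : above h p r -> next p r \/ next (rcons p true) r \/ next (rcons p false) r.
    case=> K hK; have [L hL] := dbar_stable (u r) h.+1.
    have ap : above h.+1 (take h.+1 (u r L)) r by exists L.
    have ta : take h (take h.+1 (u r L)) = p.
      rewrite -(hL (maxn K L)) ?leq_maxr// take_takel//. by apply: hK; exact: leq_maxl.
    have sa : (size (take h.+1 (u r L)) <= h.+1)%N by rewrite size_take_min geq_minl.
    move: (take _ _) ap ta sa => a ap ta; rewrite leq_eqVlt ltnS => /orP[/eqP sa|sa].
      right; case/lastP: a sa ta ap => // b x; rewrite size_rcons => -[sb].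
      rewrite -cats1 take_size_cat// cats1 => bp; rewrite -bp.
      by case: x => ap; [left|right]; split => //; rewrite -cats1 take_size_cat.
    by left; rewrite /next -ta take_oversize// take_oversize.
  have : frequently (fun r => next p r \/ next (rcons p true) r \/ next (rcons p false)
    r).
    by move=> K; have [r Kr /ext] := Ip K; exists r.
  have fin q : frequently (next q) -> exists p', I h p -> take h p' = p /\ I h.+1 p'.
    move=> nq; exists q => _; have [r _ [? _]] := nq 0%N; split => // K.
    by have [k Kk []] := nq K; exists k.
  by move=> /frequently_or[/fin //|/frequently_or[/fin //|/fin //]].
have [F hF] := choice step.
pose p := fix p h := if h is h'.+1 then F (h', p h') else [::].
have Ip h : I h (p h).
  elim: h => [|h /(hF (h, p h))[]//] K.
  by exists K => //; exists 0%N => k _; rewrite take0.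
have pS h : take h (p h.+1) = p h by have [] := hF (h, p h) (Ip h).
have pE h k : (h <= k)%N -> take h (p k) = p h.
  move=> /subnK <-; elim: (k - h)%N => [|i IH].
    by rewrite add0n -pS take_takel.
  by rewrite addSn -IH -[p (i + h)%N]pS take_takel// leq_addl.
have cau (e : R) : 0 < e -> exists N, forall i j, (N <= i)%N -> (N <= j)%N -> dist (p
  i) (p j) < e.
  move=> /exprV2_lt_eps[N Ne]; exists N => i j Ni Nj; apply: le_lt_trans Ne.
  by apply/dist_leP; rewrite !pE.
exists (Dbar cau) => N K; have [r Kr [L hL]] := Ip N K; exists r => //.
apply/dist_dbar_leP; exists (maxn N L) => k; rewrite geq_max => /andP[Nk /hL ->].
by rewrite /= pE.
Qed.

Lemma frequently_fiber (T : finType) (g : nat -> T) : exists t, frequently (fun r => g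
  r = t).
Proof.
apply: contrapT => h.
have /choice[K hK] : forall t, exists K, forall r, (K <= r)%N -> g r <> t.
  move=> t; apply: contrapT => nK; apply: h; exists t => L; apply: contrapT => nr.
  by apply: nK; exists L => r Lr gr; apply: nr; exists r.
apply: (hK (g (\max_t K t)%N) (\max_t K t)%N) => //.
exact: (leq_bigmax (g (\max_t K t)%N)).
Qed.

(** As Q gets stricter with its first argument, one diagonal choice rho eventually satisfies every Q
    N; a cluster point along rho works for all N. *)
Lemma dbar_cluster_frequently (R : realType) (u : nat -> dbar R) (Q : nat -> nat ->
  Prop) :
  (forall p q r, (p <= q)%N -> Q q r -> Q p r) -> (forall N, frequently (Q N)) ->
  exists lam, forall N, frequently (fun r => Q N r /\ dist_dbar (u r) lam <= 2 ^- N).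
Proof.
move=> Qmon hQ; have /choice[rho hrho] : forall N, exists r, (N <= r)%N /\ Q N r.
  by move=> N; have [r Nr Qr] := hQ N N; exists r.
have [lam hlam] := dbar_cluster (u \o rho).
exists lam => N K; have [r] := hlam N (maxn N K).
rewrite geq_max => /andP[Nr Kr] ur; have [rr Qr] := hrho r.
by exists (rho r); [exact: leq_trans rr|split => //; exact: Qmon Nr Qr].
Qed.

Lemma frequently_fiber_seq (B : nat) (v : nat -> seq nat) :
  frequently (fun r => (size (v r) <= B)%N /\ forall j, j \in v r -> (j <= B)%N) ->
  exists js, frequently (fun r => v r = js).
Proof.
move=> hv; have /choice[rho hrho] : forall K, exists r, (K <= r)%N /\
    ((size (v r) <= B)%N /\ forall j, j \in v r -> (j <= B)%N).
  by move=> K; have [r Kr vr] := hv K; exists r.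
pose g K : B.-bseq 'I_B.+1 := insubd [bseq] [seq inord j | j <- v (rho K)].
have gE K : [seq val i | i <- val (g K)] = v (rho K).
  have [_ [sz le]] := hrho K; rewrite insubdK ?unfold_in ?size_map//.
  rewrite -map_comp -[RHS]map_id; apply/eq_in_map => j /le jB /=.
  by rewrite inordK.
have [t ht] := frequently_fiber g.
exists [seq val i | i <- val t] => K; have [L KL gL] := ht K.
by exists (rho L); [have [+ _] := hrho L; exact: leq_trans|rewrite -gL gE].
Qed.

(** Greedy choice: by monotonicity of k and P, each new index only has to be tested against the
    previous one. *)
Lemma infinite_selection (k : nat -> nat) (P : nat -> nat -> Prop) :
  {homo k : r s / (r <= s)%N} ->
  (forall p q r, (p <= q)%N -> P q r -> P p r) ->
  (forall N, frequently (P N)) ->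
  exists Omega : set nat, [/\ infinite_set Omega,
    forall s, Omega s -> P 0%N s &
    forall r s, Omega r -> Omega s -> (r < s)%N -> P (k r) s].
Proof.
move=> kmon Pmon hP.
have /choice[F hF] : forall r, exists s, (r < s)%N /\ P (k r) s.
  by move=> r; have [s rs Ps] := hP (k r) r.+1; exists s.
(* Starting at [i.+1] makes the first term a value of F as well, so that it satisfies P 0. *)
pose psi i := iter i.+1 F 0%N.
have psiS i : (psi i < psi i.+1)%N by have [] := hF (psi i).
have psi_lt : {homo psi : i j / (i < j)%N} by apply: homo_ltn => //; exact: ltn_trans.
exists (range psi); split.
- move=> /finite_preimage fin; apply: infinite_nat.
  rewrite (_ : setT = psi @^-1` range psi); last first.
    by apply/seteqP; split => // i _; exists i.
  by apply: fin => i j _ _ /eqP; rewrite eqn_leq !(leq_mono psi_lt) -eqn_leq => /eqP.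
- by move=> _ [i _ <-]; have [_] := hF (iter i F 0%N); apply: Pmon.
move=> _ _ [i _ <-] [j _ <-]; rewrite (leqW_mono (leq_mono psi_lt)).
case: j => // j; rewrite ltnS => ij; have [_] := hF (psi j).
by apply/Pmon/kmon; rewrite (leq_mono psi_lt).
Qed.

(** * Coordinatewise multiplication of packed sequences *)

Lemma pairwise_trichotomy (T : eqType) (P : T -> T -> Prop) (s : seq T) x y :
  pairwiseb P s -> x \in s -> y \in s -> [\/ x = y, P x y | P y x].
Proof.
elim: s => //= z s IH /andP[/allP zs /IH{}IH]; rewrite !inE.
move=> /orP[/eqP ->|xs] /orP[/eqP ->|ys].
- by constructor 1.
- by constructor 2; apply/asboolP/zs.
- by constructor 3; apply/asboolP/zs.
- exact: IH.
Qed.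

(** The common pattern of the admissibility arguments: some vectors are deleted and the others start
    later, at b x instead of a x, but still before the next old starting point. *)
Lemma schreier_shift (T : eqType) (n : nat) (a b : T -> nat) (s s' : seq T) :
  {subset s' <= s} -> s' <> [::] -> (forall x, x \in s' -> (a x <= b x)%N) ->
  pairwise (fun x y => (b x < a y)%N) s' ->
  schreier n [fset i in map a s]%fset -> schreier n [fset i in map b s']%fset.
Proof.
move=> ss s'0 ab ba; apply: schreier_interlace.
- case: s' s'0 {ss ab ba} => //= x s' _ /fsetP/(_ (b x)).
  by rewrite !inE eqxx.
- move=> j; rewrite !inE => /mapP[x xs ->]; exists (a x); last exact: ab.
  by rewrite !inE map_f// ss.
move=> i j; rewrite !inE => /mapP[x xs ->] /mapP[y ys ->] bxy.
exists (a y); first by rewrite !inE map_f// ss.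
rewrite ab// andbT.
have : pairwiseb (fun x y => (b x < a y)%N) s'.
  by apply: sub_pairwise ba => u v /= uv; apply/asboolP.
move=> /pairwise_trichotomy/(_ xs ys)[E||yx] //; first by rewrite E ltnn in bxy.
by have := leq_trans yx (ab _ xs); rewrite ltnNge (ltnW bxy).
Qed.

Section functionals.
Context (R : realType) (m n : nat -> nat).
Implicit Types (f g : wfun R) (fs : seq (wfun R)) (lam : dbar R) (a : nat -> R).

(** The vector weight is kept, so neither the weight nor the node m(f) changes. Values 0 and 1 of a
    give restrictions, values 1 and -1 changes of sign. *)
Definition mulw a f : wfun R := Wfun (vw f) (fun i => a i * fn f i).

Lemma support_mulw a f : support (mulw a f) `<=` support f.
Proof. by move=> i; rewrite /support/=; apply: contraNN => /eqP ->; rewrite mulr0. Qed.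

Lemma c00_mulw a f : c00 f -> c00 (mulw a f).
Proof.
move=> [f0 ffin]; split; first by rewrite /= f0 mulr0.
apply: sub_finite_set ffin; exact: support_mulw.
Qed.

Lemma minsupp_mulw a f : fn (mulw a f) <> 0 -> (minsupp f <= minsupp (mulw a f))%N.
Proof.
move=> af0; have [ms _] := minsuppP af0.
have f0 : fn f <> 0 by move=> f0; apply: af0; apply/funext => i /=; rewrite f0 mulr0.
by have [_] := minsuppP f0; apply; exact: support_mulw ms.
Qed.

Lemma maxsupp_mulw a f : c00 f -> fn (mulw a f) <> 0 -> (maxsupp (mulw a f) <= maxsupp
  f)%N.
Proof.
move=> cf af0; have [ms _] := maxsuppP (c00_mulw a cf) af0.
have f0 : fn f <> 0 by move=> f0; apply: af0; apply/funext => i /=; rewrite f0 mulr0.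
by have [_] := maxsuppP cf f0; apply; exact: support_mulw ms.
Qed.

(** Products that vanish are deleted, as members of a packed sequence are nonzero. *)
Definition thin a fs : seq (wfun R) :=
  [seq mulw a f | f <- fs & fn (mulw a f) != 0].

Lemma thinP a fs g : g \in thin a fs -> exists f, [/\ f \in fs, g = mulw a f & fn g <> 0].
Proof.
by move=> /mapP[f]; rewrite mem_filter => /andP[/eqP gf0 ffs] ->; exists f.
Qed.

Lemma pairwise_thin a fs (P : wfun R -> wfun R -> Prop) :
  (forall f g, f \in fs -> g \in fs -> fn (mulw a f) <> 0 -> fn (mulw a g) <> 0 ->
     P f g -> P (mulw a f) (mulw a g)) ->
  pairwiseb P fs -> pairwiseb P (thin a fs).
Proof.
move=> h /(pairwise_filter (fun f => fn (mulw a f) != 0)).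
rewrite pairwise_map;
  apply: (sub_in_pairwise (P := fun f => (f \in fs) && (fn (mulw a f) != 0))).
  move=> f g /andP[ffs /eqP f0] /andP[gfs /eqP g0] /asboolP fg.
  by apply/asboolP; apply: h.
by apply/allP => f; rewrite mem_filter => /andP[f0 ffs]; apply/andP.
Qed.

Lemma before_mulw a f g : before f g -> before (mulw a f) (mulw a g).
Proof. by move=> fg i k /support_mulw fi /support_mulw; exact: fg. Qed.

Lemma linked_thin a fs : (forall f, f \in fs -> c00 f) ->
  pairwiseb (linked m) fs -> pairwiseb (linked m) (thin a fs).
Proof.
move=> cfs; apply: pairwise_thin => f g /cfs cf _ f0 _ [fg w]; split.
  exact: before_mulw.
by apply: le_trans w; rewrite lee_fin expr2_le// maxsupp_mulw.
Qed.

Lemma minsupp_head fs f : pairwiseb (linked m) fs -> (forall f, f \in fs -> fn f <> 0) ->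
  f \in fs -> (minsupp (head (wfun0 R) fs) <= minsupp f)%N.
Proof.
case: fs => //= h fs /andP[/allP hfs _] nz; rewrite inE => /orP[/eqP -> //|ffs].
have /asboolP[hf _] := hfs _ ffs; apply/ltnW/hf.
  by have [] := minsuppP (nz _ (mem_head _ _)).
by have [] := @minsuppP R f; [apply: nz; rewrite inE ffs orbT|].
Qed.

Lemma flatten_thin a (bl : seq (block R)) :
  flatten (unzip1 [seq (thin a P.1, P.2) | P <- bl & thin a P.1 != [::]]) =
  thin a (flatten (unzip1 bl)).
Proof.
elim: bl => //= P bl IH; rewrite /thin filter_cat map_cat -!/(thin _ _) -IH.
by case: eqP => [->|_].
Qed.

(** Supports shrink while weights and nodes stay the same: a smaller [maxsupp] only relaxes the
    bounds on weights and distances, and the starting points move right without passing the next old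
    one. *)
Lemma packed_thin a js lam fs : (forall f, f \in fs -> c00 f) ->
  packed m n js lam fs -> thin a fs <> [::] -> packed m n js lam (thin a fs).
Proof.
have cthin ffs : (forall f, f \in ffs -> c00 f) -> forall f, f \in thin a ffs -> c00 f.
  by move=> cf f /thinP[g [/cf cg -> _]]; exact: c00_mulw.
elim/last_ind: js lam fs => [|js j IH] lam fs cfs /[dup] pk /(packedP _ _ _ _ cfs) sp th0.
  by move E : [::] sp => js0 sp; case: sp E => // js j bl _ _ _ _ _ _; case: js.
apply/packedP; first exact: cthin.
have nz := packed_neq0 pk.
move E : (rcons js j) sp => js0 sp.
case: sp E => [j' adm lk np|js' j' bl js'0 fsE lk bk adm nb] E.
  apply: PackedOne; last 2 first.
  - exact: linked_thin.
  - apply: pairwise_thin np => f g /cfs cf _ f0 _ /le_trans; apply.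
    by apply: exprV2_le; exact: maxsupp_mulw.
  rewrite /admissible -map_comp.
  move: adm; rewrite /admissible -map_comp.
  rewrite -[in X in _ -> X]map_comp.
  apply: (schreier_shift (b := fun f => minsupp (mulw a f))).
  - by move=> f; rewrite mem_filter => /andP[].
  - by move=> E'; apply: th0; rewrite /thin E'.
  - by move=> f; rewrite mem_filter => /andP[/eqP /minsupp_mulw].
  have /pairwise_and[/(pairwise_filter (fun f => fn (mulw a f) != 0)) + _] := lk.
  apply: (sub_in_pairwise (P := fun f => (f \in fs) && (fn (mulw a f) != 0))).
    move=> f g /andP[ffs /eqP f0] /andP[gfs /eqP g0] /asboolP fg; apply: fg.
      by have [/support_mulw] := minsuppP f0.
    by have [] := minsuppP (nz _ gfs).
  by apply/allP => f; rewrite mem_filter => /andP[f0 ffs]; apply/andP.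
move: E => /eqP; rewrite eqseq_rcons => /andP[/eqP ? /eqP ?]; subst js' j'.
have blfs P f : P \in bl -> f \in P.1 -> f \in fs.
  by move=> Pb fP; rewrite fsE; apply/flattenP; exists P.1 => //; exact: map_f.
(* Blocks that vanish entirely disappear together with their points; the others keep theirs. *)
apply: (PackedRcons (bl := [seq (thin a P.1, P.2) | P <- bl & thin a P.1 != [::]])) => //.
- by rewrite flatten_thin fsE.
- exact: linked_thin.
- move=> Q /mapP[P]; rewrite mem_filter => /andP[/eqP P0 Pb] -> /=; split => //.
  by apply: IH => //; [move=> f fP; apply: cfs; exact: blfs fP|have [] := bk _ Pb].
- move: adm; rewrite /admissible -!map_comp.
  have hdin P : P \in [seq P <- bl | thin a P.1 != [::]] ->
      exists f, [/\ f \in P.1, f \in fs, head (wfun0 R) (thin a P.1) = mulw a f & fn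
        (mulw a f) <> 0].
    rewrite mem_filter => /andP[P0 Pb].
    have : head (wfun0 R) (thin a P.1) \in thin a P.1.
      by case: (thin a P.1) P0 => // g s _; rewrite mem_head.
    by move=> /thinP[f [fP E f0]]; exists f; rewrite -E; split => //; exact: blfs fP.
  have hdP P : P \in bl -> head (wfun0 R) P.1 \in P.1.
    by move=> /bk[]; case: P.1 => // f s _ _; rewrite mem_head.
  have lkf := lk; rewrite fsE pairwise_flatten in lkf; move/andP: lkf => [lkb /allP lkin].
  apply: (schreier_shift (b := fun P : block R => minsupp (head (wfun0 R) (thin a P.1)))).
  + by move=> P; rewrite mem_filter => /andP[].
  + by move=> E; apply: th0; rewrite fsE -flatten_thin E.
  + move=> P Pf; have [f [fP ffs -> f0]] := hdin P Pf.
    move: Pf; rewrite mem_filter => /andP[_ Pb].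
    apply: leq_trans (minsupp_mulw f0); apply: minsupp_head fP.
      by apply: lkin; exact: map_f.
    by move=> g gP; apply: nz; exact: blfs gP.
  move: lkb; rewrite /unzip1 pairwise_map => /(pairwise_filter (fun P : block R => thin
    a P.1 != [::])).
  apply: (sub_in_pairwise (P := mem [seq P <- bl | thin a P.1 != [::]])); last exact/allP.
  move=> P Q Pf Qf /= /allrelP PQ; have [f [fP ffs -> f0]] := hdin P Pf.
  have Qb : Q \in bl by move: Qf; rewrite /= mem_filter => /andP[].
  have /asboolP[fg _] := PQ _ _ fP (hdP Q Qb); apply: fg.
    by have [/support_mulw] := minsuppP f0.
  by have [] := @minsuppP R (head (wfun0 R) Q.1); [apply: nz; apply: blfs (hdP Q Qb)|].
rewrite pairwise_map; apply: pairwise_filter;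
  apply: sub_in_pairwise (_ : all (mem bl) bl) nb; last exact/allP.
move=> P Q Pb Qb /= /asboolP PQ; apply/asboolP => _ /thinP[f [fP -> f0]].
have le : 2 ^- maxsupp f <= 2 ^- maxsupp (mulw a f) :> R.
  by apply: exprV2_le; apply: maxsupp_mulw => //; apply: cfs; exact: blfs fP.
have [h1 h2] := PQ f fP; split; last exact: le_trans h2 le.
by move=> _ /thinP[g [/h1 gQ -> _]]; exact: le_trans gQ le.
Qed.

End functionals.

(** * The norming set *)

Lemma c00_sum (R : realType) (T : eqType) (s : seq T) (F : T -> nat -> R) :
  (forall t, t \in s -> c00 (F t)) -> c00 (\sum_(t <- s) F t).
Proof.
move=> h; rewrite big_seq; apply: (big_ind (fun x => c00 x)) => //.
- by split => //; apply: (@sub_finite_set _ _ set0) => // i; rewrite /support/= eqxx.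
- move=> x y [x0 xf] [y0 yf]; split; first by rewrite fctE x0 y0 addr0.
  apply: (@sub_finite_set _ _ (support x `|` support y)); last by rewrite finite_setU.
  move=> i; rewrite /support /= fctE; have [->|? _] := eqVneq (x i) 0; last by left.
  by rewrite add0r; right.
Qed.

Lemma c00_scale (R : realType) (c : R) (x : nat -> R) : c00 x -> c00 (c *: x).
Proof.
move=> [x0 xf]; split; first by rewrite fctE x0 scaler0.
apply: sub_finite_set xf => i; rewrite /support /= fctE.
by apply: contraNN => /eqP ->; rewrite scaler0.
Qed.

Lemma support_unit_vec (R : realType) i : support (unit_vec i : nat -> R) = [set i].
Proof.
apply/seteqP; split=> k; last by move=> ->;
  rewrite /support/mkset /unit_vec eqxx oner_eq0.
by have [->//|ki] := eqVneq k i; rewrite /support/mkset /unit_vec (negbTE ki) eqxx.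
Qed.

Lemma c00_unit_vec (R : realType) i : (0 < i)%N -> c00 (unit_vec i : nat -> R).
Proof.
move=> i0; split; last by rewrite support_unit_vec; exact: finite_set1.
by rewrite /unit_vec; case: i i0.
Qed.

Lemma unit_vec_neq0 (R : realType) i : unit_vec i <> 0 :> (nat -> R).
Proof. by move/(congr1 (fun x => x i)) => /eqP; rewrite /unit_vec eqxx oner_eq0. Qed.

Lemma minsupp_unit_vec (R : realType) i : minsupp (unit_vec i : nat -> R) = i.
Proof. by have [] := minsuppP (@unit_vec_neq0 R i); rewrite support_unit_vec. Qed.

Section norming_set.
Context (R : realType) (m n : nat -> nat).
Implicit Types (f g : wfun R) (fs : seq (wfun R)) (lam : dbar R) (a : nat -> R).

Definition Wset : set (wfun R) := \bigcup_k W_level m n k.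

Definition coeff (js : seq nat) : R := (\prod_(j <- js) m j)%N%:R^-1.

Definition unit_fun i : wfun R := Wfun [::] (unit_vec i).

(** Basis functionals have infinite weight and sit at the root. With the root for all points, the
    weight and distance conditions are automatic, and admissibility is split one weight at a time by
    [schreier_convolution]. *)
Lemma packed_unit_fun js t : js <> [::] -> sorted ltn t ->
  schreier (\sum_(j <- js) n j)%N [fset i in t]%fset ->
  packed m n js (of_node R [::]) [seq unit_fun i | i <- t].
Proof.
have near0 lam i k : lam = of_node R [::] -> dist_m (unit_fun i) lam <= 2 ^- k.
  move=> ->; rewrite /dist_m (_ : phi (mindex (unit_fun i)) = [::]) ?dist_dbarxx//.
  by rewrite /mindex big_nil.
have lnk t' : sorted ltn t' -> pairwiseb (linked m) [seq unit_fun i | i <- t'].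
  rewrite sorted_pairwise ?pairwise_map; last exact: ltn_trans.
  apply: sub_pairwise => i j /= ij; apply/asboolP; split; last exact: leey.
  by move=> p q; rewrite /= !support_unit_vec => -> ->.
have mins t' : [seq minsupp (fn f) | f <- [seq unit_fun i | i <- t']] = t'.
  by rewrite -map_comp -[RHS]map_id; apply: eq_map => i /=; exact: minsupp_unit_vec.
elim/last_ind: js t => // js j IH t _ srt sch.
have c00t f : f \in [seq unit_fun i | i <- t] -> c00 f.
  move=> /mapP[i it ->]; apply: c00_unit_vec; apply: schreier_gt0 sch _.
  by rewrite !inE.
apply/packedP => //; have [js0|js0] := eqVneq js [::].
  rewrite js0; apply: PackedOne.
  - rewrite /admissible -map_comp mins.
    by move: sch; rewrite js0 /= big_cons big_nil addn0.
  - exact: lnk.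
  - rewrite pairwise_map; elim: (t) => //= i s ->; rewrite andbT; apply/allP => k _.
    by apply/asboolP; exact: near0.
move: sch; rewrite -cats1 big_cat big_cons big_nil /= addn0 cats1.
move=> /(schreier_convolution srt)[tt [tE ttin tth]].
apply: (PackedRcons (bl := [seq ([seq unit_fun i | i <- u], of_node R [::]) | u <- tt])).
- exact/eqP.
- by rewrite /unzip1 -map_comp tE map_flatten.
- exact: lnk.
- move=> P /mapP[u utt ->] /=; have [u0 su] := ttin u utt; split;
  first by case: u u0 {utt su}.
  apply: IH => //; first exact/eqP.
  move: srt; rewrite tE !sorted_pairwise; try exact: ltn_trans.
  by rewrite pairwise_flatten => /andP[_ /allP]; apply.
- rewrite /admissible -!map_comp.
  rewrite (_ : map _ tt = [seq head 0%N u | u <- tt])//.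
  apply/eq_in_map => u /ttin[u0 _] /=; case: u u0 => // i u _ /=.
  exact: minsupp_unit_vec.
rewrite pairwise_map; elim: (tt) => //= u s ->; rewrite andbT; apply/allP => v _.
apply/asboolP => f _; split; last exact: dist_dbarxx.
by move=> g /mapP[i _ ->]; exact: near0.
Qed.

(** Thus W_1 also arises from W_0 by packing, and inductions on W have only the basis functionals
    and the packed case to treat. *)
Lemma W_schreier_packed f : W_schreier m n f -> W_packed m n W_zero f.
Proof.
move=> [pos [F sch fE]]; split => //.
exists (of_node R [::]), [seq unit_fun i | i <- sorted_elts F]; split.
- move=> k; rewrite size_map => kF; rewrite (nth_map 0%N)//; split => //.
  exists (nth 0%N (sorted_elts F) k); last by left.
  by apply: schreier_gt0 sch _; rewrite -mem_sorted_elts mem_nth.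
- apply: packed_unit_fun; first by case/andP: pos => /eqP.
    exact: sorted_elts_ltn.
  by rewrite fset_sorted_elts.
- rewrite fE big_map; congr (_ *: _); apply: perm_big.
  by rewrite perm_sym perm_sort.
Qed.

Lemma W_packed_mem (V : set (wfun R)) f : W_packed m n V f <->
  positive_indices (vw f) /\ exists lam fs, [/\ forall g, g \in fs -> V g,
    packed m n (vw f) lam fs & fn f = coeff (vw f) *: \sum_(g <- fs) fn g].
Proof.
by split=> -[pos [lam [fs [/(all_nth (wfun0 R) V) h pk fE]]]]; split => //;
  exists lam, fs.
Qed.

Lemma W_packed_sub (V V' : set (wfun R)) : V `<=` V' -> W_packed m n V `<=` W_packed m
  n V'.
Proof. by move=> VV' f [pos [lam [fs [h pk fE]]]]; split => //; exists lam, fs;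
  split => // i /h /VV'. Qed.

Lemma Wset_ind (P : wfun R -> Prop) :
  (forall f, W_zero f -> P f) ->
  (forall f, W_packed m n (fun g => Wset g /\ P g) f -> P f) ->
  forall f, Wset f -> P f.
Proof.
move=> h0 hS f [k _]; elim: k f => [//|k IH] f.
have zero g : W_zero g -> Wset g /\ P g by move=> Wg; split; [exists 0%N|exact: h0].
case: k IH => [|k] IH; first by case=> [/h0//|/W_schreier_packed/(W_packed_sub zero)/hS].
by case=> [/IH//|Wf]; apply: hS; apply: W_packed_sub Wf => g Wg; split;
  [exists k.+1|exact: IH].
Qed.

Lemma W_zero_Wset f : W_zero f -> Wset f.
Proof. by exists 0%N. Qed.

Lemma W_level_le k l : (k <= l)%N -> W_level m n k `<=` @W_level R m n l.
Proof.
move=> /subnK <-; elim: (l - k)%N => // i IH f /IH; rewrite addSn.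
by case: (i + k)%N => [|p]; left.
Qed.

Lemma W_packed_Wset f : W_packed m n Wset f -> Wset f.
Proof.
move=> /W_packed_mem[pos [lam [fs [h pk fE]]]].
have [k hk] : exists k, forall g, g \in fs -> W_level m n k g.
  elim: fs h {pk fE} => [|g fs IH] h; first by exists 0%N.
  have [|k hk] := IH; first by move=> g' g'fs; apply: h; rewrite inE g'fs orbT.
  have [l _ gl] := h g (mem_head _ _).
  exists (maxn k l) => g'; rewrite inE => /orP[/eqP ->|/hk].
    by apply: W_level_le gl; exact: leq_maxr.
  by apply: W_level_le; exact: leq_maxl.
(* Packing enters the definition from level 2 on, whence [k.+2] even for k = 0. *)
exists k.+2 => //; right; apply/W_packed_mem; split => //; exists lam, fs; split => //.
by move=> g /hk; apply: W_level_le.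
Qed.

Lemma c00_Wset f : Wset f -> c00 f.
Proof.
move: f; apply: Wset_ind => [f [_ [i i0 [] ->]]|f /W_packed_mem[_ [lam [fs [h _ ->]]]]].
- exact: c00_unit_vec.
- by rewrite -scaleN1r; apply/c00_scale/c00_unit_vec.
- by apply/c00_scale/c00_sum => g /h[].
Qed.

Lemma Wset_cases f : Wset f -> W_zero f \/ W_packed m n Wset f.
Proof.
move: f; apply: Wset_ind => f Wf; first by left.
by right; apply: W_packed_sub Wf => g [].
Qed.

(* The unit vector basis is 1-unconditional and W is closed under restrictions. *)
Lemma Wset_mulw a f : (forall i, a i = 0 \/ a i = 1 \/ a i = - 1) ->
  Wset f -> fn (mulw a f) <> 0 -> Wset (mulw a f).
Proof.
move=> ha; move: f; apply: Wset_ind => [f|f /W_packed_mem[pos [lam [fs [h pk fE]]]] af0].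
  case=> vwf [i i0 fE] af0; apply: W_zero_Wset; split => //; exists i => //=.
  have aE : (fun k => a k * f k) = a i *: fn f.
    apply/funext => k; rewrite fctE; have [->//|ki] := eqVneq k i.
    suff -> : fn f k = 0 by rewrite mulr0 scaler0.
    by case: fE => ->; rewrite ?fctE /unit_vec (negbTE ki) ?oppr0.
  move: af0; rewrite /= aE; case: (ha i) => [->|[->|->]].
  - by rewrite scale0r.
  - by rewrite scale1r.
  - by rewrite scaleN1r; case: fE => ->; rewrite ?opprK; [right|left].
apply: W_packed_Wset; apply/W_packed_mem; split => //; exists lam, (thin a fs).
have sumE : \sum_(g <- thin a fs) fn g = \sum_(g <- fs) fn (mulw a g).
  rewrite big_map big_filter [RHS](bigID (fun g => fn (mulw a g) != 0))/=.
  rewrite [X in _ = _ + X]big1 ?addr0// => g; rewrite negbK => /eqP //.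
have afE : fn (mulw a f) = coeff (vw f) *: \sum_(g <- thin a fs) fn g.
  apply/funext => i; rewrite /= fE sumE !fctE !fct_sumE mulrCA; congr (_ * _).
  by rewrite mulr_sumr.
split => //.
- by move=> _ /thinP[g [/h[_ Wg] -> ag0]]; exact: Wg.
- apply: packed_thin => // [g /h[/c00_Wset]//|th0].
  by apply: af0; rewrite afE th0 big_nil scaler0.
Qed.

End norming_set.

(** * Norming functionals of a single vector *)

Lemma pairingE (R : realType) (A : {fset nat}) (f x : nat -> R) :
  (forall i, support x i -> i \in A) -> pairing f x = \sum_(i <- A) f i * x i.
Proof.
move=> xA; apply: fsbigTE => i iA; suff -> : x i = 0 by rewrite mulr0.
by apply: contrapT => /eqP /xA; rewrite (negbTE iA).
Qed.

Lemma c00_fset (R : realType) (x : nat -> R) : c00 x ->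
  exists A : {fset nat}, forall i, support x i -> i \in A.
Proof. by move=> [_ xf]; exists (fset_set (support x)) => i xi;
  rewrite in_fset_set// inE. Qed.

Lemma pairing_suml (R : realType) (T : Type) (s : seq T) (F : T -> nat -> R) (x : nat
  -> R) c :
  c00 x -> pairing (c *: \sum_(t <- s) F t) x = c * \sum_(t <- s) pairing (F t) x.
Proof.
move=> /c00_fset[A xA]; rewrite (pairingE _ xA).
under [in RHS]eq_bigr do rewrite (pairingE _ xA).
rewrite exchange_big mulr_sumr /=; apply: eq_bigr => i _.
by rewrite !fctE fct_sumE -mulr_suml mulrA.
Qed.

Lemma pairingZl (R : realType) (f x : nat -> R) c : c00 x ->
  pairing (c *: f) x = c * pairing f x.
Proof. by move=> cx; have := pairing_suml [:: f] id c cx; rewrite !big_seq1. Qed.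

Lemma pairing_sumr (R : realType) (T : eqType) (s : seq T) (x : T -> nat -> R) (c : T
  -> R) f :
  (forall t, t \in s -> c00 (x t)) ->
  pairing f (\sum_(t <- s) c t *: x t) = \sum_(t <- s) c t * pairing f (x t).
Proof.
move=> cx.
have [A xA] : exists A : {fset nat}, forall t, t \in s -> forall i, support (x t) i ->
  i \in A.
  elim: s cx => [|t s IH] cx; first by exists fset0.
  have [|A hA] := IH; first by move=> t' t's; apply: cx; rewrite inE t's orbT.
  have [B hB] := c00_fset (cx t (mem_head _ _)).
  exists (A `|` B)%fset => t'; rewrite inE => /orP[/eqP -> i /hB|/hA h i /h];
    rewrite inE => -> //.
  by rewrite orbT.
rewrite (@pairingE _ A); last first.
  move=> i; rewrite /support/= fct_sumE; apply: contraNT => iA.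
  rewrite big_seq big1// => t ts; rewrite fctE; apply/eqP.
  rewrite scaler_eq0; apply/orP; right; apply: contraNT iA; exact: (xA t).
rewrite big_seq [RHS]big_seq.
under [in RHS]eq_bigr => t ts do rewrite (pairingE _ (xA t ts)) mulr_sumr.
rewrite -!big_seq exchange_big /=; apply: eq_bigr => i _.
rewrite fct_sumE mulr_sumr; apply: eq_bigr => t _; rewrite fctE.
by rewrite mulrCA.
Qed.

Lemma eq_pairing (R : realType) (f g x y : nat -> R) :
  (forall i, f i * x i = g i * y i) -> pairing f x = pairing g y.
Proof. by move=> h; apply: eq_fsbigr => i _. Qed.

Section norm.
Context (R : realType) (m n : nat -> nat).
Implicit Types (f g : wfun R) (fs : seq (wfun R)) (lam : dbar R) (a x : nat -> R).

(** [sup] is 0 by convention where there is no supremum, so for normalized vectors the norm is a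
    genuine supremum. *)
Lemma normX_has_sup x : normX m n x != 0 -> has_sup [set pairing f x | f in W m n].
Proof. by apply: contraNP => /sup_out; rewrite /normX => ->. Qed.

Lemma pairing_le1 f x : normX m n x = 1 -> Wset m n f -> pairing f x <= 1.
Proof.
move=> x1 Wf; rewrite -x1; apply: (sup_upper_bound (normX_has_sup _)).
  by rewrite x1 oner_eq0.
by exists (fn f) => //; exists f.
Qed.

Lemma pairing_ge_eps x e : normX m n x = 1 -> 0 < e ->
  exists2 f, Wset m n f & 1 - e < pairing f x.
Proof.
move=> x1 e0; have h : has_sup [set pairing f x | f in W m n].
  by apply: normX_has_sup; rewrite x1 oner_eq0.
have [_ [_ [f Wf <-] <-]] := sup_adherent e0 h.
by rewrite -/(normX m n x) x1; exists f.
Qed.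

Lemma pairing_abs_le1 f x : c00 x -> normX m n x = 1 -> Wset m n f ->
  `|pairing f x| <= 1.
Proof.
move=> cx x1 Wf; rewrite ler_norml (pairing_le1 x1 Wf) andbT lerNl.
have nE : fn (mulw (fun=> - 1) f) = - 1 *: fn f by apply/funext => i; rewrite fctE.
have -> : - pairing f x = pairing (fn (mulw (fun=> - 1) f)) x.
  by rewrite nE pairingZl// mulN1r.
have [->|/eqP nf0] := eqVneq (fn (mulw (fun=> - 1) f)) 0.
  by have := pairingZl 0 0 cx; rewrite mul0r scale0r => ->.
apply: pairing_le1 => //; apply: Wset_mulw => // i; by right; right.
Qed.

Lemma packed_linked js lam fs : (forall f, f \in fs -> c00 f) ->
  packed m n js lam fs -> pairwiseb (linked m) fs.
Proof. by move=> cfs /(packedP _ _ _ _ cfs)[]. Qed.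

Lemma support_linked_sum fs g : pairwiseb (linked m) fs -> g \in fs ->
  support g `<=` support (\sum_(f <- fs) fn f).
Proof.
move=> lk gfs i gi; case/splitPr: gfs lk => s1 s2.
rewrite pairwise_cat /= => /and3P[/allrelP h1 _ /andP[/allP h2 _]].
rewrite /support/= big_cat big_cons /= !fctE !fct_sumE.
rewrite big_seq big1 ?add0r; last first.
  move=> f fs1; have /asboolP[fg _] := h1 f g fs1 (mem_head _ _).
  by apply: contrapT => /eqP fi; have := fg _ _ fi gi; rewrite ltnn.
rewrite big_seq big1 ?addr0// => f fs2; have /asboolP[gf _] := h2 f fs2.
by apply: contrapT => /eqP fi; have := gf _ _ gi fi; rewrite ltnn.
Qed.

Lemma coeff_rcons js j : coeff R m (rcons js j) = coeff R m js * (m j)%:R^-1.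
Proof. by rewrite /coeff -cats1 big_cat big_seq1 /= natrM invfM. Qed.

(** F1 is the first functional if there is one weight, and the first block otherwise. Packing
    constrains the distance to lam from the second piece on, so all of rest is near lam. As F1 is
    packed for the remaining weights (or a single member of W), its contribution is H / m_j with H
    in W. *)
Lemma packed_split js lam fs : positive_indices js ->
  (forall f, f \in fs -> Wset m n f) -> packed m n js lam fs ->
  exists F1 rest, [/\ fs = F1 ++ rest, F1 <> [::],
    forall f g, f \in F1 -> g \in rest -> linked m f g /\ near_past lam f g,
    rest <> [::] -> packed m n js lam rest &
    exists H j, [/\ Wset m n H, (0 < j)%N &
      coeff R m js *: \sum_(f <- F1) fn f = (m j)%:R^-1 *: fn H]].
Proof.
move=> pos Wfs pk.
have cfs f : f \in fs -> c00 f by move=> /Wfs /c00_Wset.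
have nz := packed_neq0 pk.
have /(packedP _ _ _ _ cfs) sp := pk.
case: sp pos Wfs cfs nz => {pk js} [j adm lk np|js j bl js0 fsE lk bk adm nb] pos Wfs
  cfs nz.
  case: fs adm lk np Wfs cfs nz => [/admissible_neq_nil//|g rest].
  move=> adm lk np Wfs cfs nz;
    move: (lk) (np) => /= /andP[/allP lkg lkr] /andP[/allP npg npr].
  exists [:: g], rest; split => //.
  - move=> f h; rewrite inE => /eqP -> hr; split; apply/asboolP; [exact: lkg|exact: npg].
  - move=> r0; apply/packedP; first by move=> f fr; apply: cfs; rewrite inE fr orbT.
    apply: PackedOne => //; move: adm; rewrite /admissible -!map_comp.
    apply: schreier_shift => //; first by move=> f; rewrite inE orbC => ->.
    apply: sub_in_pairwise (_ : all (mem rest) rest) lkr; last exact/allP.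
    move=> f h fr hr /asboolP[fh _]; apply: fh.
      by have [] := @minsuppP R f; [apply: nz; rewrite inE fr orbT|].
    by have [] := @minsuppP R h; [apply: nz; rewrite inE hr orbT|].
  exists g, j; split => //; first by apply: Wfs; rewrite mem_head.
    by case/andP: pos => _ /=; rewrite andbT.
  by rewrite !big_seq1 /coeff big_seq1.
case: bl fsE bk adm nb => [|P bl] fsE bk adm nb.
  by have := admissible_neq_nil adm.
move: nb => /= /andP[/allP nbP nb].
have memfs Q f : Q \in P :: bl -> f \in Q.1 -> f \in fs.
  by move=> Qb fQ; rewrite fsE; apply/flattenP; exists Q.1 => //; apply: map_f.
move: (lk); rewrite fsE /= pairwise_cat => /and3P[/allrelP lkP lkP1 lkr].
exists P.1, (flatten (unzip1 bl)); split => //.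
- by have [] := bk P (mem_head _ _).
- move=> f g fP gr; split; first by apply/asboolP; exact: lkP.
  move: gr => /flattenP[_ /mapP[Q Qb ->] gQ].
  have /asboolP/(_ f fP)[h1 h2] := nbP Q Qb.
  (* From m(g) to the point of its block and from there to lam: the ultrametric inequality keeps the
     same bound. *)
  exact: dist_dbar_trans (h1 g gQ) h2.
- move=> r0; apply/packedP.
    by move=> f /flattenP[_ /mapP[Q Qb ->] fQ]; apply/cfs/(memfs Q);
      rewrite ?inE ?Qb ?orbT.
  apply: (PackedRcons (bl := bl)) => //.
    by move=> Q Qb; apply: bk; rewrite inE Qb orbT.
  have hdQ Q : Q \in bl -> head (wfun0 R) Q.1 \in Q.1.
    move=> Qb; have [] := bk Q _; first by rewrite inE Qb orbT.
    by case: Q.1 => // f s _ _; rewrite mem_head.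
  have hd0 Q : Q \in bl -> fn (head (wfun0 R) Q.1) <> 0.
    by move=> Qb; apply: nz; apply: (memfs Q); [rewrite inE Qb orbT|exact: hdQ].
  move: adm; rewrite /admissible -!map_comp.
  apply: schreier_shift => //.
  + by move=> f; rewrite inE orbC => ->.
  + by move=> bl0; apply: r0; rewrite bl0.
  move: lkr; rewrite pairwise_flatten /unzip1 pairwise_map => /andP[+ _].
  apply: sub_in_pairwise (_ : all (mem bl) bl); last exact/allP.
  move=> Q Q' Qb Q'b /allrelP /(_ _ _ (hdQ _ Qb) (hdQ _ Q'b)) /asboolP[fg _].
  by apply: fg; [have [] := minsuppP (hd0 _ Qb)|have [] := minsuppP (hd0 _ Q'b)].
have [posjs j0] : positive_indices js /\ (0 < j)%N.
  by case/andP: pos => _; rewrite all_rcons => /andP[? ?]; split => //; apply/andP;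
    split => //; apply/eqP.
exists (Wfun js (coeff R m js *: \sum_(f <- P.1) fn f)), j; split => //.
  apply: W_packed_Wset; apply/W_packed_mem; split => //; exists P.2, P.1; split => //.
    by move=> g gP; apply: Wfs; apply: memfs gP; rewrite mem_head.
  by have [] := bk P (mem_head _ _).
by rewrite coeff_rcons mulrC scalerA.
Qed.

(* In the packed case, rest is what remains of f after deleting its first
   block. The deleted part is g / m_j with g in W: either it contributes little,
   or g itself almost norms x while having a smaller support. *)
Definition splits x f lam rest N : Prop :=
  [/\ positive_indices (vw f), packed m n (vw f) lam rest, support x N,
    forall g, g \in rest -> [/\ Wset m n g, support g `<=` support x,
      ((2 ^+ N)%:E <= weight m g)%E & dist_m g lam <= 2 ^- N] &
    99%:R / 100%:R <= coeff R m (vw f) * \sum_(g <- rest) pairing g x].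

Context (m100 : forall j, (0 < j)%N -> (100 <= m j)%N).

Lemma coeff_gt0 js : positive_indices js -> 0 < coeff R m js.
Proof.
move=> /andP[_ /allP js0]; rewrite /coeff invr_gt0 ltr0n big_seq.
by apply: prodn_cond_gt0 => j /js0 /m100; apply: leq_trans.
Qed.

(** Induction on the bound B of the support: replacing f by H lowers B by one and multiplies the
    tolerance by at most 100. For B = 0 the functional would be 0, yet of value at least 0.99. *)
Lemma norming_functional_aux x B f : c00 x -> normX m n x = 1 ->
  Wset m n f -> support f `<=` support x -> (forall i, support f i -> (i < B)%N) ->
  1 - 100 ^- B.+1 <= pairing f x ->
  exists f lam rest N, [/\ Wset m n f, support f `<=` support x,
    99%:R / 100%:R <= pairing f x & vw f <> [::] -> splits x f lam rest N].
Proof.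
move=> cx x1; elim: B f => [|B IH] f Wf fx fB fval.
  have f0 : fn f = 0.
    by apply/funext => i; apply: contrapT => /eqP /fB.
  exfalso; move: fval; rewrite f0 (_ : pairing 0 x = 0); last first.
    have := pairingZl 0 0 cx; rewrite mul0r scale0r //.
  by lra.
have f99 : 99%:R / 100%:R <= pairing f x.
  apply: le_trans fval; rewrite exprSr invfM.
  have : (100 ^- B.+1 : R) <= 1 by rewrite invf_le1 ?exprn_ege1 ?exprn_gt0// ler1n.
  lra.
case: (Wset_cases Wf) => [[vwf _]|/W_packed_mem[pos [lam [fs [Wfs pk fE]]]]].
  by exists f, (of_node R [::]), [::], 0%N; split => //; rewrite vwf.
have cfs g : g \in fs -> c00 g by move=> /Wfs /c00_Wset.
have lk := packed_linked cfs pk.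
have gx g : g \in fs -> support g `<=` support f.
  move=> gfs i /(support_linked_sum lk gfs); rewrite /support /= fE fctE.
  by rewrite scaler_eq0 (gt_eqF (coeff_gt0 pos)).
have [F1 [rest [fsE F10 lnk prest [H [j [WH j0 HE]]]]]] := packed_split pos Wfs pk.
have fval2 : pairing f x = (m j)%:R^-1 * pairing H x + coeff R m (vw f) * \sum_(g <-
  rest) pairing g x.
  rewrite fE fsE pairing_suml// big_cat mulrDr -pairing_suml// HE pairingZl//.
have [rx|rx] := lerP (99%:R / 100%:R) (coeff R m (vw f) * \sum_(g <- rest) pairing g x).
  have rest0 : rest <> [::].
    by move=> r0; move: rx; rewrite r0 big_nil mulr0; lra.
  have [h hF1] : exists h, h \in F1.
    by case: F1 F10 {fsE lnk HE} => // h F1 _; exists h; rewrite mem_head.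
  have hfs : h \in fs by rewrite fsE mem_cat hF1.
  (* Any h in F1 yields a suitable N, since every member of rest is linked to it and near lam
     relative to it. *)
  exists f, lam, rest, (maxsupp h); split => // _; split => //.
  - exact: prest.
  - have [hs _] := maxsuppP (cfs _ hfs) (packed_neq0 pk hfs).
    by apply: fx; apply: gx hs.
  move=> g gr; have gfs : g \in fs by rewrite fsE mem_cat gr orbT.
  have [[_ w] np] := lnk _ _ hF1 gr; split => //; first exact: Wfs.
  exact: subset_trans (gx _ gfs) fx.
have mj : (100 : R) <= (m j)%:R by rewrite ler_nat m100.
have mj0 : 0 < (m j)%:R :> R by exact: lt_le_trans mj.
have Hval : 1 - 100 ^- B.+1 <= pairing H x.
  have h1 : 1 / 100 - 100 ^- B.+2 < (m j)%:R^-1 * pairing H x by lra.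
  have e2 : (100 ^- B.+2 : R) = 100 ^- B.+1 / 100 by rewrite exprSr invfM.
  have B1 : (100 ^- B.+1 : R) <= 1 by rewrite invf_le1 ?exprn_ege1 ?exprn_gt0// ler1n.
  (* 1/100 - 100^-(B+2) is exactly (1 - 100^-(B+1)) / 100, and multiplication by m_j >= 100 cancels
     the denominator. *)
  have h2 : (1 - 100 ^- B.+1) / 100 * (m j)%:R <= pairing H x.
    rewrite -ler_pdivlMr// [_ / (m j)%:R]mulrC; apply/ltW; apply: le_lt_trans h1; lra.
  apply: le_trans h2; rewrite -mulrA ler_peMr ?subr_ge0//.
  by rewrite mulrC ler_pdivlMr ?mul1r.
have H1 := pairing_le1 x1 WH.
have Hf : fn H = (m j)%:R *: (coeff R m (vw f) *: \sum_(g <- F1) fn g).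
  by rewrite HE scalerA mulfV ?scale1r// gt_eqF.
have HF1 i : support H i -> exists2 g, g \in F1 & support g i.
  move=> Hi; apply: contrapT => nF1; move: Hi; rewrite /support /= Hf !fctE fct_sumE.
  rewrite big_seq big1 ?scaler0 ?eqxx// => g gF1.
  by apply: contrapT => /eqP gi; apply: nF1; exists g.
(* With nothing after F1, f(x) = H(x) / m_j would be at most 1/100. *)
have [rest0|rest0] := eqVneq rest [::].
  exfalso; move: fval2; rewrite rest0 big_nil mulr0 addr0 => fH.
  have : (m j)%:R^-1 * pairing H x <= 100^-1.
    rewrite mulrC ler_pdivrMr//; apply: le_trans H1 _; lra.
  by rewrite -fH; lra.
have [g gr] : exists g, g \in rest.
  by case: (rest) rest0 => // g r _; exists g; rewrite mem_head.
have gfs : g \in fs by rewrite fsE mem_cat gr orbT.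
have [gi _] := minsuppP (packed_neq0 pk gfs).
apply: (IH H) => //.
  move=> i /HF1[h hF1 hi]; apply: fx; apply: gx hi; by rewrite fsE mem_cat hF1.
(* H ends strictly before g, and g starts at or before B. *)
move=> i /HF1[h hF1 hi]; have [[hg _] _] := lnk _ _ hF1 gr.
have := fB _ (gx _ gfs _ gi); rewrite ltnS; apply: leq_trans; exact: hg.
Qed.

Lemma norming_functional x : c00 x -> normX m n x = 1 ->
  exists f lam rest N, [/\ Wset m n f, support f `<=` support x,
    99%:R / 100%:R <= pairing f x & vw f <> [::] -> splits x f lam rest N].
Proof.
move=> cx x1; have [A xA] := c00_fset cx.
(* B depends on x alone, so the tolerance is fixed before f is chosen; f is then restricted to supp
   x. *)
pose B := (\max_(i <- A) i).+1.
have [|f Wf fval] := @pairing_ge_eps x (100 ^- B.+1) x1.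
  by rewrite invr_gt0 exprn_gt0.
pose a i : R := (x i != 0)%:R.
have aE : pairing (fn (mulw a f)) x = pairing f x.
  by apply: eq_pairing => i /=; rewrite /a; case: eqP => [->|_]; rewrite ?mulr0// mul1r.
apply: (@norming_functional_aux x B (mulw a f)) => //; last 3 first.
- by move=> i; rewrite /support /= /a; have [_|//] := eqVneq (x i) 0;
  rewrite /= mul0r eqxx.
- move=> i; rewrite /support /= /a; have [_|/xA iA _] := eqVneq (x i) 0;
  first by rewrite /= mul0r eqxx.
  by rewrite ltnS; apply: leq_bigmax_seq.
- by rewrite aE ltW.
apply: Wset_mulw => //.
  by move=> i; rewrite /a; case: eqP; [left|right; left].
move=> af0; move: fval; rewrite -aE af0 (_ : pairing 0 x = 0); last first.
  by have := pairingZl 0 0 cx; rewrite mul0r scale0r.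
have : (100 ^- B.+1 : R) <= 1 by rewrite invf_le1 ?exprn_ege1 ?exprn_gt0// ler1n.
lra.
Qed.

End norm.

(** * Assembling functionals on disjoint blocks *)

Section assembly.
Context (R : realType) (m n : nat -> nat) (x : nat -> nat -> R).
Context (hx : block_sequence x).
Implicit Types (f g : wfun R) (lam : dbar R) (G : {fset nat}) (h : nat -> nat -> R).

Lemma block_c00 r : c00 (x r). Proof. by have [/(_ r)[]] := hx. Qed.

Lemma block_before r s i k : (r < s)%N -> support (x r) i -> support (x s) k -> (i < k)%N.
Proof. by have [_ h] := hx; move=> /h; apply. Qed.

Lemma block_disjoint r s i : support (x r) i -> support (x s) i -> r = s.
Proof.
move=> ri si; case: (ltngtP r s) => // rs.
  by have := block_before rs ri si; rewrite ltnn.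
by have := block_before rs si ri; rewrite ltnn.
Qed.

Lemma block_maxsupp r i : support (x r) i -> (i <= maxsupp (x r))%N.
Proof. by have [/(_ r)[cr r0] _] := hx; have [_] := maxsuppP cr r0; apply. Qed.

Lemma block_maxsupp_support r : support (x r) (maxsupp (x r)).
Proof. by have [/(_ r)[cr r0] _] := hx; have [] := maxsuppP cr r0. Qed.

Lemma pairing_block_sum (s : seq nat) h c r :
  (forall t, support (h t) `<=` support (x t)) -> uniq s -> r \in s ->
  pairing (c *: \sum_(t <- s) h t) (x r) = c * pairing (h r) (x r).
Proof.
move=> hx' us rs; rewrite pairing_suml; last exact: block_c00.
rewrite (bigD1_seq r)//= big1 ?addr0// => t tr.
rewrite /pairing fsbig1// => i _; apply/eqP; rewrite mulf_eq0 -[_ || _]negbK negb_or.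
apply/negP => /andP[ti ri]; move/eqP: tr; apply.
exact: block_disjoint (hx' _ _ ti) ri.
Qed.

Hint Resolve block_c00 : core.

(** One functional serves all scalars: it is multiplied on supp x_r by the sign of c_r. *)
Lemma normX_ge_signs G c q f : (forall r, normX m n (x r) = 1) -> 0 < q -> G <> fset0 ->
  Wset m n f -> (forall r, r \in G -> q <= pairing f (x r)) ->
  q * \sum_(r <- G) `|c r| <= normX m n (\sum_(r <- G) c r *: x r).
Proof.
move=> x1 q0 G0 Wf fq.
pose a i : R := if `[< exists r, [/\ r \in G, support (x r) i & c r < 0] >] then -1
  else 1.
have aE r i : r \in G -> support (x r) i -> a i = if c r < 0 then -1 else 1.
  move=> rG ri; rewrite /a; case: asboolP => [[s [sG si cs]]|na].
    by rewrite (block_disjoint ri si) cs.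
  by case: ifP => // cr; case: na; exists r.
have afE r : r \in G -> c r * pairing (fn (mulw a f)) (x r) = `|c r| * pairing f (x r).
  move=> rG.
  have -> : pairing (fn (mulw a f)) (x r) = (if c r < 0 then -1 else 1) * pairing f (x r).
    rewrite -pairingZl//; apply: eq_pairing => i /=; rewrite fctE.
    have [->|/(aE _ _ rG) ->//] := eqVneq (x r i) 0; by rewrite !mulr0.
  by rewrite mulrA; case: ltP => cr;
    [rewrite ltr0_norm// mulrN1|rewrite ger0_norm// mulr1].
have Waf : Wset m n (mulw a f).
  apply: Wset_mulw => //; first by move=> i; rewrite /a; case: ifP; right; [right|left].
  move=> af0; have /eqP/fset0Pn[r rG] := G0.
  have f0 : fn f = 0.
    apply/funext => i; move: af0 => /(congr1 (fun y => y i)) /= /eqP.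
    rewrite mulf_eq0 => /orP[|/eqP //]; rewrite /a.
    by case: ifP; rewrite ?oppr_eq0 oner_eq0.
  have := pairingZl 0 0 (block_c00 r); rewrite mul0r scale0r => p0.
  by have := fq r rG; rewrite f0 p0 leNgt q0.
apply: (@le_trans _ _ (pairing (fn (mulw a f)) (\sum_(r <- G) c r *: x r))).
  rewrite pairing_sumr// mulr_sumr big_seq [leRHS]big_seq; apply: ler_sum => r rG.
  by rewrite afE// mulrC ler_wpM2l// fq.
(* The values on the sum are bounded by the sum of the |c_r|, because the x_r are normalized. *)
apply: ub_le_sup; last by exists (fn (mulw a f)) => //; exists (mulw a f).
exists (\sum_(r <- G) `|c r|) => _ [_ [g Wg <-] <-].
rewrite pairing_sumr//; apply: ler_sum => r _.
apply: le_trans (ler_norm _) _; rewrite normrM ler_piMr//.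
exact: pairing_abs_le1 (block_c00 r) (x1 r) Wg.
Qed.

(** Spreading: a point of supp x_r is at least its minimum and precedes the minimum of every later
    block. *)
Lemma admissible_blocks G k (b : nat -> nat) :
  admissible k [seq x r | r <- G] -> (forall r, support (x r) (b r)) ->
  schreier k [fset i in [seq b r | r <- sorted_elts G]]%fset.
Proof.
move=> adm hb.
have Gne : sorted_elts G <> [::].
  move=> G0; apply: (admissible_neq_nil adm); apply: size0nil.
  by rewrite size_map -(size_sort leq) -/(sorted_elts G) G0.
move: adm; rewrite /admissible -map_comp; apply: schreier_shift => //.
- by move=> r; rewrite mem_sorted_elts.
- by move=> r _ /=; have [/(_ r)[_ /minsuppP[_ xmin]] _] := hx; apply: xmin.
have := sorted_elts_ltn G; rewrite sorted_pairwise; last exact: ltn_trans.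
apply: sub_pairwise => r s rs /=; apply: (block_before rs) => //.
by have [/(_ s)[_ /minsuppP[]]] := hx.
Qed.

Lemma pairwise_sorted_elts G (Q : nat -> nat -> Prop) :
  (forall r s, r \in G -> s \in G -> (r < s)%N -> Q r s) -> pairwiseb Q (sorted_elts G).
Proof.
move=> h; have := sorted_elts_ltn G; rewrite sorted_pairwise; last exact: ltn_trans.
apply: sub_in_pairwise (_ : all (mem G) _).
  by move=> r s rG sG rs; apply/asboolP; apply: h.
by apply/allP => r; rewrite mem_sorted_elts.
Qed.

Lemma sorted_elts_uniq G : uniq (sorted_elts G).
Proof. by rewrite sort_uniq fset_uniq. Qed.

(** The bounds refer to [maxsupp (x r)], which dominates [maxsupp (f r)], so they give the packing
    conditions for the f r with the single weight m_j. *)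
Lemma assemble_fast (f : nat -> wfun R) lam G j : (0 < j)%N ->
  (forall r, [/\ Wset m n (f r), support (f r) `<=` support (x r) & 0 < pairing (f r)
    (x r)]) ->
  (forall r s, r \in G -> s \in G -> (r < s)%N ->
     ((2 ^+ maxsupp (x r))%:E <= weight m (f s))%E /\ dist_m (f s) lam <= 2 ^- maxsupp
       (x r)) ->
  admissible (n j) [seq x r | r <- G] ->
  exists2 F, Wset m n F &
    forall r, r \in G -> pairing F (x r) = (m j)%:R^-1 * pairing (f r) (x r).
Proof.
move=> j0 hf hG adm.
have cf r : c00 (f r) by have [/c00_Wset] := hf r.
have f0 r : fn (f r) <> 0.
  have [_ _ fr] := hf r => fr0; move: fr; rewrite fr0.
  by have := pairingZl 0 0 (block_c00 r); rewrite mul0r scale0r => ->; rewrite ltxx.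
have fx r : support (f r) `<=` support (x r) by have [] := hf r.
have maxf r : (maxsupp (f r) <= maxsupp (x r))%N.
  by apply/block_maxsupp/fx; have [] := maxsuppP (cf r) (f0 r).
exists (Wfun [:: j] (coeff R m [:: j] *: \sum_(r <- sorted_elts G) fn (f r))); last first.
  move=> r rG; rewrite /= pairing_block_sum ?sorted_elts_uniq ?mem_sorted_elts//.
  by rewrite /coeff big_seq1.
apply: W_packed_Wset; apply/W_packed_mem; split; first by rewrite /positive_indices /= j0.
exists lam, [seq f r | r <- sorted_elts G]; split; last by rewrite big_map.
  by move=> _ /mapP[r _ ->]; have [] := hf r.
apply/packedP; first by move=> _ /mapP[r _ ->].
apply: PackedOne.
- rewrite /admissible -!map_comp; apply: admissible_blocks => // r /=.
  by apply: fx; have [] := minsuppP (f0 r).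
- rewrite pairwise_map; apply: pairwise_sorted_elts => r s rG sG rs; split.
    by move=> i k /fx ri /fx; exact: block_before rs ri.
  by have [w _] := hG _ _ rG sG rs; apply: le_trans w; rewrite lee_fin expr2_le.
rewrite pairwise_map; apply: pairwise_sorted_elts => r s rG sG rs.
have [_ d] := hG _ _ rG sG rs; apply: le_trans d _; exact: exprV2_le.
Qed.

(** The lists rest r with their points lams r become the blocks of a sequence packed for js followed
    by j. Conditions between different blocks hold since N s lies in supp x_s, beyond
    [maxsupp (x r)] for every r < s. *)
Lemma assemble_split (f : nat -> wfun R) (lams : nat -> dbar R)
    (rest : nat -> seq (wfun R)) (N : nat -> nat) js lam G j :
  (0 < j)%N -> js <> [::] ->
  (forall r, r \in G -> vw (f r) = js) ->
  (forall r, r \in G -> splits m n (x r) (f r) (lams r) (rest r) (N r)) ->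
  (forall r s, r \in G -> s \in G -> (r < s)%N ->
     dist_dbar (lams s) lam <= 2 ^- maxsupp (x r)) ->
  admissible (n j) [seq x r | r <- G] ->
  exists2 F, Wset m n F &
    forall r, r \in G -> pairing F (x r) =
      (m j)%:R^-1 * (coeff R m js * \sum_(g <- rest r) pairing g (x r)).
Proof.
move=> j0 js0 fjs sp near adm.
(* Nothing is known outside G; the empty list there makes the support inclusions hold for all r. *)
pose rs r := if r \in G then rest r else [::].
have rsG r : r \in G -> rs r = rest r by rewrite /rs => ->.
have restx r g : g \in rs r -> [/\ r \in G, Wset m n g & support g `<=` support (x r)].
  rewrite /rs; case: ifP => // rG gr.
  by have [_ _ _ /(_ g gr)[]] := sp r rG.
have rest0 r : r \in G -> rest r <> [::].
  move=> rG r0; have [_ _ _ _] := sp r rG; rewrite r0 big_nil mulr0.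
  by rewrite leNgt divr_gt0.
pose h r := \sum_(g <- rs r) fn g.
have hsupp r : support (h r) `<=` support (x r).
  move=> i; rewrite /support /= /h fct_sumE; apply: contraNN => /eqP xi.
  rewrite big_seq big1// => g /restx[_ _ gx]; apply: contrapT => /eqP /gx.
  by rewrite /support /= xi eqxx.
exists (Wfun (rcons js j) (coeff R m (rcons js j) *: \sum_(r <- sorted_elts G) h r));
  last first.
  move=> r rG; rewrite /= pairing_block_sum ?sorted_elts_uniq ?mem_sorted_elts//.
  rewrite coeff_rcons mulrCA -mulrA; congr (_ * (_ * _)).
  rewrite /h rsG//; have := pairing_suml (rest r) (fun g : wfun R => fn g) 1 (block_c00
    r).
  by rewrite scale1r mul1r.
have /eqP/fset0Pn[r0 r0G] : G <> fset0.
  by move=> G0; apply: (admissible_neq_nil adm); rewrite G0.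
have pos : positive_indices (rcons js j).
  have [pos _ _ _ _] := sp r0 r0G; rewrite fjs// in pos; move/andP: pos => [_ pos].
  by apply/andP; split; [case: (js)|rewrite all_rcons j0].
have NS r g : r \in G -> g \in rest r -> (maxsupp g <= maxsupp (x r))%N.
  move=> rG; rewrite -rsG// => gr; have [_ /c00_Wset cg gx] := restx r g gr.
  have g0 : fn g <> 0.
    by have [_ pk _ _ _] := sp r rG; apply: (packed_neq0 pk); rewrite -rsG.
  by apply/block_maxsupp/gx; have [] := maxsuppP cg g0.
pose bl := [seq (rest r, lams r) | r <- sorted_elts G].
have flE : flatten (unzip1 bl) = flatten [seq rest r | r <- sorted_elts G].
  by rewrite /unzip1 -map_comp.
have flP g : g \in flatten (unzip1 bl) -> exists2 r, r \in G & g \in rest r.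
  rewrite flE => /flattenP[_ /mapP[r rG ->] gr]; exists r => //.
  by rewrite -mem_sorted_elts.
have flW g : g \in flatten (unzip1 bl) -> Wset m n g.
  by move=> /flP[r rG]; rewrite -rsG// => /restx[].
apply: W_packed_Wset; apply/W_packed_mem; split => //.
exists lam, (flatten (unzip1 bl)); split => //; last first.
  congr (_ *: _); rewrite flE big_flatten big_map /=.
  rewrite big_seq [RHS]big_seq; apply: eq_bigr => r; rewrite mem_sorted_elts => rG.
  by rewrite /h rsG.
have linkN r s f' g : r \in G -> s \in G -> (r < s)%N -> f' \in rest r -> g \in rest s ->
    linked m f' g.
  move=> rG sG lt_rs fr gs; have [_ _ NsG /(_ g gs)[_ gx w _] _] := sp s sG.
  have [_ _ _ /(_ f' fr)[_ fx _ _] _] := sp r rG; split.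
    by move=> i k /fx ri /gx; exact: block_before lt_rs ri.
  apply: le_trans w; rewrite lee_fin expr2_le//; apply: leq_trans (NS _ _ rG fr) _.
  exact: ltnW (block_before lt_rs (block_maxsupp_support r) NsG).
apply/packedP; first by move=> g /flW /c00_Wset.
apply: (PackedRcons (bl := bl)) => //.
- rewrite flE pairwise_flatten; apply/andP; split.
    rewrite pairwise_map; apply: sub_pairwise (pairwise_sorted_elts _).
      move=> r s /asboolP; exact.
    move=> r s rG sG lt_rs; apply/allrelP => f' g fr gs; apply/asboolP.
    exact: linkN lt_rs fr gs.
  apply/allP => s /mapP[r]; rewrite mem_sorted_elts => rG ->.
  have [_ pk _ _ _] := sp r rG; apply: packed_linked pk.
  by move=> g; rewrite -rsG// => /restx[_ /c00_Wset].
- move=> P /mapP[r]; rewrite mem_sorted_elts => rG -> /=; split; first exact: rest0.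
  by have [_ + _ _ _] := sp r rG; rewrite fjs.
- rewrite /admissible -!map_comp.
  (* [admissible_blocks] asks for a point of each supp x_r; outside G any one will do. *)
  pose b r := if r \in G then minsupp (head (wfun0 R) (rest r)) else maxsupp (x r).
  rewrite (_ : map _ _ = [seq b r | r <- sorted_elts G]).
    apply: admissible_blocks => // r; rewrite /b; case: ifP => rG;
      last exact: block_maxsupp_support.
    have hr : head (wfun0 R) (rest r) \in rest r.
      by move: (rest0 r rG); case: (rest r) => // g s _; rewrite mem_head.
    have [_ pk _ /(_ _ hr)[_ gx _ _] _] := sp r rG; apply: gx.
    by have [] := minsuppP (packed_neq0 pk hr).
  by apply/eq_in_map => r; rewrite mem_sorted_elts /b => ->.
rewrite pairwise_map; apply: pairwise_sorted_elts => r s rG sG lt_rs g gr.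
have le : 2 ^- maxsupp (x r) <= 2 ^- maxsupp g :> R by apply: exprV2_le; exact: NS gr.
split; last exact: le_trans (near _ _ rG sG lt_rs) le.
move=> g' gs; have [_ _ NsG /(_ g' gs)[_ _ _ d] _] := sp s sG.
apply: le_trans (d) _; apply: le_trans le; apply: exprV2_le.
exact: ltnW (block_before lt_rs (block_maxsupp_support r) NsG).
Qed.

End assembly.

(** * Finiteness of the vector weights of bounded weight *)

Section parameter_bounds.
Context (R : realType) (m n : nat -> nat) (hmn : parameters R m n).

Lemma parameters_ge100 j : (0 < j)%N -> (100 <= m j)%N.
Proof.
rewrite -(m_one hmn) leq_eqVlt => /orP[/eqP <- //|j1].
by apply/ltnW/(m_increasing hmn); rewrite j1.
Qed.

Lemma parameters_gt_id j : (0 < j)%N -> (j < m j)%N.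
Proof.
elim: j => // -[|j] IH _; first by rewrite (m_one hmn).
by apply: leq_ltn_trans (IH isT) _; apply: (m_increasing hmn); rewrite /= ltnS leqnn.
Qed.

(** Each factor m_j is at least 2 and exceeds j, so a bound on the weight bounds both the number and
    the size of the indices. *)
Lemma prod_weights_bound js : (forall j, j \in js -> (0 < j)%N) ->
  (size js <= \prod_(j <- js) m j)%N /\
  forall j, j \in js -> (j <= \prod_(j <- js) m j)%N.
Proof.
elim: js => [|k js IH] pos; first by split.
have [j jjs|sz le] := IH; first by apply: pos; rewrite inE jjs orbT.
have k0 : (0 < k)%N by apply: pos; rewrite mem_head.
have p0 : (0 < \prod_(j <- js) m j)%N.
  rewrite big_seq; apply: prodn_cond_gt0 => j jjs.
  by apply: leq_trans (parameters_ge100 _); rewrite // pos// inE jjs orbT.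
rewrite big_cons /=; move: (\prod_(j <- js) m j)%N p0 sz le => P P0 sz le.
have m2 : (2 <= m k)%N by apply: leq_trans (parameters_ge100 k0).
have PmP : (P.+1 <= m k * P)%N.
  by apply: (@leq_trans (2 * P));
    rewrite ?leq_mul2r ?m2 ?orbT// mul2n -addnn -addn1 leq_add2l.
split; first exact: leq_trans PmP.
move=> j; rewrite inE => /orP[/eqP ->|/le lej]; last exact: leq_trans lej (ltnW PmP).
by apply: leq_trans (ltnW (parameters_gt_id k0)) _; rewrite leq_pmulr.
Qed.

End parameter_bounds.

(** * Selection of the subsequence *)

Theorem theorem3p4 (R : realType) (m n : nat -> nat) (hmn : parameters R m n)
    (x : nat -> nat -> R) (hx : block_sequence x)
    (hx1 : forall r, normX m n (x r) = 1) :
  exists2 Omega : set nat, infinite_set Omega &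
    forall (j0 : nat), (0 < j0)%N ->
    forall (Gamma : {fset nat}) (c : nat -> R),
      [set` Gamma] `<=` Omega ->
      admissible (n j0) [seq x r | r <- Gamma] ->
      normX m n (\sum_(r <- Gamma) c r *: x r)
        >= 99%:R / 100%:R * (m j0)%:R^-1 * \sum_(r <- Gamma) `|c r|.
Proof.
have m100 := parameters_ge100 hmn.
have cx := block_c00 hx.
have /choice[d hd] : forall r, exists d : wfun R * dbar R * seq (wfun R) * nat,
    [/\ Wset m n d.1.1.1, support d.1.1.1 `<=` support (x r),
      99%:R / 100%:R <= pairing d.1.1.1 (x r) &
      vw d.1.1.1 <> [::] -> splits m n (x r) d.1.1.1 d.1.1.2 d.1.2 d.2].
  move=> r; have [f [lam [rest [N h]]]] := norming_functional m100 (cx r) (hx1 r).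
  by exists (f, lam, rest, N).
pose f r := (d r).1.1.1; pose lams r := (d r).1.1.2.
have q0 : 0 < 99%:R / 100%:R :> R by rewrite divr_gt0.
have kmon : {homo (fun r => maxsupp (x r)) : r s / (r <= s)%N}.
  move=> r s; rewrite leq_eqVlt => /orP[/eqP -> //|rs].
  exact: ltnW (block_before hx rs (block_maxsupp_support hx r) (block_maxsupp_support
    hx s)).
(* The scalars are left to [normX_ge_signs]; one functional F per set G remains to be found. *)
suff: exists2 Omega : set nat, infinite_set Omega &
    forall j0, (0 < j0)%N -> forall G : {fset nat}, [set` G] `<=` Omega ->
      admissible (n j0) [seq x r | r <- G] ->
      exists2 F, Wset m n F & forall r, r \in G ->
        99%:R / 100%:R * (m j0)%:R^-1 <= pairing F (x r).
  case=> Omega Oinf hO; exists Omega => // j0 j00 G c GO adm.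
  have [F WF Fq] := hO _ j00 _ GO adm.
  apply: (normX_ge_signs hx _ hx1 _ _ WF Fq).
    by rewrite mulr_gt0// invr_gt0 ltr0n (leq_trans _ (m100 _ j00)).
  by move=> G0; apply: (admissible_neq_nil adm); rewrite G0.
pose heavy N r := ((2 ^+ N)%:E <= weight m (f r))%E.
(* Basis functionals, of infinite weight, count as heavy for every N. *)
have [fast|slow] := pselect (forall N, frequently (heavy N)).
  have hmon p q r : (p <= q)%N -> heavy q r -> heavy p r.
    by move=> pq; apply: le_trans; rewrite lee_fin expr2_le.
  have [lam hlam] := @dbar_cluster_frequently _ (fun r => of_node R (phi (mindex (f r))))
    heavy hmon fast.
  have [|Omega [Oinf _ hO]] := @infinite_selection _
      (fun N r => heavy N r /\ dist_m (f r) lam <= 2 ^- N) kmon _ hlam.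
    move=> p q r pq [w dr]; split; first exact: hmon w.
    exact: le_trans dr (exprV2_le _ pq).
  exists Omega => // j0 j00 G GO adm.
  have hf r : [/\ Wset m n (f r), support (f r) `<=` support (x r) & 0 < pairing (f r)
    (x r)].
    by have [Wf fx fv _] := hd r; split => //; exact: lt_le_trans fv.
  have hG r s : r \in G -> s \in G -> (r < s)%N ->
      heavy (maxsupp (x r)) s /\ dist_m (f s) lam <= 2 ^- maxsupp (x r).
    by move=> rG sG; apply: hO; exact: GO.
  have [F WF FE] := assemble_fast hx j00 hf hG adm.
  exists F => // r /FE ->; rewrite mulrC ler_wpM2l ?invr_ge0//.
  by have [] := hd r.
(* Failure of the first case bounds the weights of all late f r, which therefore are not basis
   functionals and have a splitting. *)
have [N [K hK]] : exists N K, forall r, (K <= r)%N -> ~ heavy N r.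
  apply: contrapT => h; apply: slow => N K; apply: contrapT => nr; apply: h.
  by exists N, K => r Kr w; apply: nr; exists r.
have vwK r : (K <= r)%N -> vw (f r) <> [::] /\ (\prod_(j <- vw (f r)) m j <= 2 ^ N)%N.
  move=> /hK; rewrite /heavy /weight; case: (vw (f r)) => [|j js]; first by rewrite leey.
  by rewrite lee_fin -natrX ler_nat => /negP; rewrite -ltnNge => /ltnW.
have [js hjs] : exists js, frequently (fun r => (K <= r)%N /\ vw (f r) = js).
  (* 2^N bounds the weight, hence the length and the entries of the vector weight; the shift by K
     discards the terms where this may fail. *)
  have [|js hjs] := @frequently_fiber_seq (2 ^ N) (fun r => vw (f (K + r)%N)).
    move=> L; exists L => //; have [vw0 le] := vwK (K + L)%N (leq_addr _ _).
    have [_ _ _ /(_ vw0)[/andP[_ /allP pos] _ _ _ _]] := hd (K + L)%N.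
    have [sz lej] := prod_weights_bound hmn pos.
    by split => [|j /lej]; [exact: leq_trans le|move=> /leq_trans; apply].
  exists js => L; have [r Lr vr] := hjs L.
  by exists (K + r)%N; [exact: leq_trans Lr (leq_addl _ _)|split => //; exact: leq_addr].
have [lam hlam] := @dbar_cluster_frequently _ lams (fun _ r => (K <= r)%N /\ vw (f r) =
  js)
  (fun p q r _ => id) (fun=> hjs).
(* [hO0] fixes the vector weight on all of Omega, its first element included, while [hO] gives the
   fast convergence of the points. *)
have [|Omega [Oinf hO0 hO]] := @infinite_selection _
    (fun N r => ((K <= r)%N /\ vw (f r) = js) /\ dist_dbar (lams r) lam <= 2 ^- N) kmon
      _ hlam.
  by move=> p q r pq [w dr]; split => //; exact: le_trans dr (exprV2_le _ pq).
exists Omega => // j0 j00 G GO adm.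
have vwG r : r \in G -> vw (f r) <> [::] /\ vw (f r) = js.
  by move=> /GO /hO0[[/vwK[? _] ?] _].
have js0 : js <> [::].
  by have [r _ [/vwK[+ _]]] := hjs 0%N => /[swap] ->.
have fjs r : r \in G -> vw (f r) = js by move=> /vwG[].
have hsp r : r \in G -> splits m n (x r) (f r) (lams r) (d r).1.2 (d r).2.
  by move=> /vwG[f0 _]; have [_ _ _] := hd r; apply.
have near r s : r \in G -> s \in G -> (r < s)%N -> dist_dbar (lams s) lam <= 2 ^-
  maxsupp (x r).
  by move=> rG sG rs; have [_] := hO _ _ (GO _ rG) (GO _ sG) rs.
have [F WF FE] := assemble_split hx j00 js0 fjs hsp near adm.
exists F => // r rG; rewrite FE// mulrC ler_wpM2l ?invr_ge0//.
by have [_ _ _ _] := hsp r rG; rewrite fjs.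
Qed.
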